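(* Let $f:\mathbb{R}^n\times\mathbb{R}^m\to\mathbb{R}^n$ be continuous with $\sup_{y\in\mathbb{R}^m}|f(x,y)|\le a+b|x|$ for all $x\in\mathbb{R}^n$, for some $a,b>0$. Let $g:\mathbb{R}^n\times\mathbb{R}^m\times\mathbb{R}\to\mathbb{R}^m$ be admissible (for every compact $K\subset\mathbb{R}^n\times\mathbb{R}^m$, $g$ is bounded and uniformly continuous on $K\times\mathbb{R}$) and uniformly Lipschitz in $y$ on compact sets (for all compact $K_0\subset\mathbb{R}^n$, $K\subset\mathbb{R}^m$ there is $L=L(K_0,K)$ with $|g(x,y_1,\tau)-g(x,y_2,\tau)|\le L|y_1-y_2|$ for all $y_1,y_2\in K$, $x\in K_0$, $\tau\in\mathbb{R}$). Let $\mathcal{H}$ be the hull of $g$. Assume that for each $h\in\mathcal{H}$, $x\in\mathbb{R}^n$, $y_0\in\mathbb{R}^m$ the solution $y(\tau,h,x,y_0)$ is defined for all $\tau\ge 0$, and that for each compact $K_0\subset\mathbb{R}^n$ the solutions of the parametric family $y'=g(x,y,\tau)$, $x\in K_0$, are uniformly ultimately bounded. Fix $x_0\in\mathbb{R}^n$, $y_0\in\mathbb{R}^m$, $t_0>0$, and let $\varepsilon_k\downarrow0$ be such that the problems $$\dot x=f(x,y),\qquad \varepsilon\dot y=g(x,y,t/\varepsilon),\qquad x(0)=x_0,\ y(0)=y_0$$ with $\varepsilon=\varepsilon_k$ have solutions $(x_{\varepsilon_k}(t),y_{\varepsilon_k}(t))$ on $[0,t_0]$ with $x_{\varepsilon_k}(t)$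 converging to $x_0(t)$ uniformly on $[0,t_0]$. Write $Y_{\varepsilon_k}(\tau):=y_{\varepsilon_k}(\varepsilon_k\tau)$, $\tau\in[0,t_0/\varepsilon_k]$. For a fixed small $r>0$ let $K_0:=\{x_0(t)+x\mid t\in[0,t_0],\ x\in\mathbb{R}^n,\ |x|\le r\}$ and let $\mathbb{A}\subset\mathcal{H}\times K_0\times\mathbb{R}^m$ be the global attractor of the layered skew-product semiflow $\pi$ on $\mathcal{H}\times K_0\times\mathbb{R}^m$, with sections $A_{(h,x)}$. For each integer $k\ge1$ let $$\delta_k:=\inf\big\{\delta>0\mid\mathrm{dist}\big(Y_{\varepsilon_k}(t_0/\varepsilon_k),A_{(g\cdot(t_0/\varepsilon_k),\,x_0(t_0))}[\delta]\big)\le\delta\big\}.$$ Then: (i) $\lim_{k\to\infty}\delta_k=0$; (ii) $\lim_{k\to\infty}\mathrm{dist}\big(Y_{\varepsilon_k}(t_0/\varepsilon_k),A_{(g\cdot(t_0/\varepsilon_k),\,x_0(t_0))}[\delta_k]\big)=0$; (iii) if $g\cdot(t_0/\varepsilon_k)\to h_0$ in $(\mathcal{H},d)$ as $k\to\infty$, then $h_0\in\mathcal{O}(g)$ and $\lim_{k\to\infty}\mathrm{dist}\big(Y_{\varepsilon_k}(t_0/\varepsilon_k),A_{(h_0,\,x_0(t_0))}\big)=0$.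
   Context: Hull. $(g\cdot s)(x,y,\tau)=g(x,y,\tau+s)$; $\mathcal{H}$ is the closure of $\{g\cdot s\mid s\in\mathbb{R}\}$ in the compact-open topology, a compact metric space with a fixed metric $d$, on which $(\tau,h)\mapsto h\cdot\tau$ (translation in the last variable) is a continuous flow. $\mathcal{O}(g)\subset\mathcal{H}$ is the omega-limit set of $g$, i.e. the set of limits of sequences $g\cdot\tau_k$ with $\tau_k\to\infty$. Solutions. For $h\in\mathcal{H}$, $x\in\mathbb{R}^n$: $y(\tau,h,x,\tau_0,y_0)$ is the solution of $y'=h(x,y,\tau)$ ($x$ a fixed parameter) with $y(\tau_0)=y_0$, and $y(\tau,h,x,y_0):=y(\tau,h,x,0,y_0)$. Uniform ultimate boundedness of $y'=g(x,y,\tau)$, $x\in K_0$: there is $c>0$ such that for every $\rho>0$ there is $T=T(\rho)$ with $|y(\tau+\tau_0,g,x,\tau_0,y_0)|\le c$ for all $x\in K_0$, $\tau_0\in\mathbb{R}$, $\tau\ge T$, $|y_0|\le \rho$. Layered semiflow: $\pi(\tau,h,x,y_0)=(h\cdot\tau,x,y(\tau,h,x,y_0))$, $\tau\ge0$, on $\mathcal{H}\times K_0\times\mathbb{R}^m$. Under the stated assumptions it has a global attractor $\mathbb{A}$, i.e. the nonempty compact set with $\pi_\tau(\mathbb{A})=\mathbb{A}$ for all $\tau\ge0$ and $\lim_{\tau\to\infty}\mathrm{dist}(\pi_\tau(\mathcal{H}\times K_0\times D),\mathbb{A})=0$ for every bounded $D\subset\mathbb{R}^m$. Sections: $A_{(h,x)}=\{y\mid(h,x,y)\in\mathbb{A}\}$.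 Parametrically inflated pullback attractor: for $\delta\ge0$, $A_{(h,x)}[\delta]=\bigcup A_{(\tilde h,\tilde x)}$, the union over $(\tilde h,\tilde x)\in\mathcal{H}\times K_0$ with $\max\{d(h,\tilde h),|x-\tilde x|\}\le\delta$ (so $A_{(h,x)}[0]=A_{(h,x)}$). $\mathrm{dist}(Y_1,Y_2)=\sup_{y_1\in Y_1}\inf_{y_2\in Y_2}d(y_1,y_2)$ is the Hausdorff semidistance (distance from a point to a set when $Y_1$ is a point). *)

(* Defs.v *)
From HB Require Import structures.
From mathcomp Require Import all_boot all_order all_algebra.
From mathcomp Require Import all_classical all_reals all_analysis.

Set Implicit Arguments.
Unset Strict Implicit.
Unset Printing Implicit Defensive.

Import Order.TTheory GRing.Theory Num.Theory.
Import numFieldNormedType.Exports.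

Local Open Scope classical_set_scope.
Local Open Scope ring_scope.

(* Euclidean norm; the norm [`|x|] that the library puts on row vectors is the
   sup norm, which induces the same topology. *)
Definition eunorm (R : realType) (n : nat) (x : 'rV[R]_n) : R :=
  Num.sqrt (\sum_(i < n) x 0 i ^+ 2).

Definition eudist (R : realType) (n : nat) (x y : 'rV[R]_n) : R := eunorm (x - y).

(* Hausdorff semidistance for the distance function [rho]. The [maxe 0] only
   matters for [Y1 = set0]: the supremum is taken in [0, +oo]. The distance to
   the empty set is [+oo]. *)
Definition hdist (R : realType) (T : Type) (rho : T -> T -> R)
    (Y1 Y2 : set T) : \bar R :=
  maxe 0%E (ereal_sup [set ereal_inf [set (rho y1 y2)%:E | y2 in Y2] | y1 in Y1]).

(* [v] is the derivative of [u] at [t] relative to [I]: one-sided at the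
   endpoints of an interval [I]. *)
Definition derivative_within (R : realType) (V : normedModType R)
    (I : set R) (u : R -> V) (t : R) (v : V) : Prop :=
  (s - t)^-1 *: (u s - u t) @[s --> within I t^'] --> v.

Definition solves_on (R : realType) (V : normedModType R)
    (I : set R) (F : R -> V -> V) (u : R -> V) : Prop :=
  forall t, I t -> derivative_within I u t (F t (u t)).

(* Time-dependent vector fields (x, y, tau) |-> h (x, y, tau) on R^m with
   parameter x in R^n, with the compact-open topology. *)
Definition pfield (R : realType) (n m : nat) : topologicalType :=
  {compact-open, ('rV[R]_n * 'rV[R]_m * R)%type -> 'rV[R]_m}.

Section Skew.
Context {R : realType} {n m : nat}.
Implicit Types (h g : pfield R n m) (x : 'rV[R]_n) (y : 'rV[R]_m).

Definition admissible (g : pfield R n m) : Prop :=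
  forall K : set ('rV[R]_n * 'rV[R]_m), compact K ->
    (exists M : R, forall p tau, K p -> eunorm (g (p, tau)) <= M) /\
    (forall e : R, 0 < e -> exists2 eta : R, 0 < eta &
       forall p1 p2 tau1 tau2, K p1 -> K p2 ->
         eudist p1.1 p2.1 < eta -> eudist p1.2 p2.2 < eta ->
         `|tau1 - tau2| < eta ->
         eudist (g (p1, tau1)) (g (p2, tau2)) < e).

Definition lipschitz_in_y (g : pfield R n m) : Prop :=
  forall (K0 : set 'rV[R]_n) (K : set 'rV[R]_m), compact K0 -> compact K ->
    exists L : R, forall x y1 y2 tau, K0 x -> K y1 -> K y2 ->
      eudist (g (x, y1, tau)) (g (x, y2, tau)) <= L * eudist y1 y2.

Definition translate (h : pfield R n m) (s : R) : pfield R n m :=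
  fun p => h (p.1, p.2 + s).

(* [pfield] contains all functions; intersecting with the continuous ones gives
   the closure in the space of continuous functions. *)
Definition hull (g : pfield R n m) : set (pfield R n m) :=
  closure (range (translate g)) `&`
  [set h : pfield R n m | continuous (h : 'rV[R]_n * 'rV[R]_m * R -> 'rV[R]_m)].

Definition omega_limit (g : pfield R n m) : set (pfield R n m) :=
  [set h | hull g h /\
     exists2 tau : nat -> R, tau k @[k --> \oo] --> +oo &
       translate g (tau k) @[k --> \oo] --> h].

(* [d] is a metric on [H] inducing the subspace topology of [H]. *)
Definition metrizes (H : set (pfield R n m))
    (d : pfield R n m -> pfield R n m -> R) : Prop :=
  [/\ forall h1 h2, H h1 -> H h2 -> 0 <= d h1 h2 /\ (d h1 h2 = 0 <-> h1 = h2),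
      forall h1 h2, H h1 -> H h2 -> d h1 h2 = d h2 h1,
      forall h1 h2 h3, H h1 -> H h2 -> H h3 -> d h1 h3 <= d h1 h2 + d h2 h3 &
      forall h (U : set (pfield R n m)), H h ->
        (within H (nbhs h) U <->
         exists2 e : R, 0 < e & forall h', H h' -> d h h' < e -> U h')].

Definition forward_solution h x (tau0 : R) y0 : set (R -> 'rV[R]_m) :=
  [set u | u tau0 = y0 /\
     solves_on `[tau0, +oo[ (fun tau y => h (x, y, tau)) u].

(* y(tau, h, x, tau0, y0) for tau >= tau0, provided that a forward solution
   exists; it is then unique if [h] is Lipschitz in [y] on compact sets. *)
Definition sol h x (tau0 : R) y0 (tau : R) : 'rV[R]_m :=
  xget (fun=> 0) (forward_solution h x tau0 y0) tau.

Definition uniformly_ultimately_bounded (g : pfield R n m)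
    (K0 : set 'rV[R]_n) : Prop :=
  exists2 c : R, 0 < c &
    forall rho : R, 0 < rho -> exists2 T : R, 0 <= T &
      forall x tau0 tau y0, K0 x -> T <= tau -> eunorm y0 <= rho ->
        eunorm (sol g x tau0 y0 (tau + tau0)) <= c.

Definition skew_semiflow (tau : R) (p : pfield R n m * 'rV[R]_n * 'rV[R]_m) :
    pfield R n m * 'rV[R]_n * 'rV[R]_m :=
  (translate p.1.1 tau, p.1.2, sol p.1.1 p.1.2 0 p.2 tau).

Definition skew_dist (d : pfield R n m -> pfield R n m -> R)
    (p q : pfield R n m * 'rV[R]_n * 'rV[R]_m) : R :=
  Num.max (Num.max (d p.1.1 q.1.1) (eudist p.1.2 q.1.2)) (eudist p.2 q.2).

Definition global_attractor (H : set (pfield R n m))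
    (d : pfield R n m -> pfield R n m -> R) (K0 : set 'rV[R]_n)
    (A : set (pfield R n m * 'rV[R]_n * 'rV[R]_m)) : Prop :=
  [/\ A `<=` H `*` K0 `*` setT,
      A !=set0,
      compact A,
      forall tau, 0 <= tau -> skew_semiflow tau @` A = A &
      forall D : set 'rV[R]_m, bounded_set D ->
        hdist (skew_dist d) (skew_semiflow tau @` (H `*` K0 `*` D)) A
          @[tau --> +oo] --> 0%E].

Definition asection (A : set (pfield R n m * 'rV[R]_n * 'rV[R]_m)) h x :
    set 'rV[R]_m :=
  [set y | A (h, x, y)].

(* The size [delta >= 0] of the inflation may be [+oo], so that an infimum of
   sizes taken in [\bar R] is again a size. *)
Definition inflated (H : set (pfield R n m))
    (d : pfield R n m -> pfield R n m -> R) (K0 : set 'rV[R]_n)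
    (A : set (pfield R n m * 'rV[R]_n * 'rV[R]_m)) h x (delta : \bar R) :
    set 'rV[R]_m :=
  \bigcup_(p in [set p : pfield R n m * 'rV[R]_n | [/\ H p.1, K0 p.2 &
                   ((Num.max (d h p.1) (eudist x p.2))%:E <= delta)%E]])
    asection A p.1 p.2.

(* inf {delta > 0 | dist(y, B(delta)) <= delta}, with inf set0 = +oo *)
Definition least_inflation (y : 'rV[R]_m) (B : \bar R -> set 'rV[R]_m) : \bar R :=
  ereal_inf [set delta%:E | delta in
    [set delta : R | 0 < delta /\
       (hdist (@eudist R m) [set y] (B delta%:E) <= delta%:E)%E]].

End Skew.

Definition tube (R : realType) (n : nat) (u : R -> 'rV[R]_n) (t0 r : R) :
    set 'rV[R]_n :=
  [set u t + x | t in `[0, t0] & x in [set x | eunorm x <= r]].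

(* Main.v *)
(* In the fast time tau = t / eps_k the solution Y_k solves
   Y' = g (X_k (tau), Y, tau) with a slowly varying parameter X_k, so on fast-time
   windows of a fixed length T it stays close to the solution of the system whose
   parameter is frozen. This needs a bound on [0, T] for the frozen solutions that
   is uniform over all translates of g; it follows from the compactness of the
   hull and global existence over the hull. Chaining windows, uniform ultimate
   boundedness keeps Y_k in a fixed bounded set, up to the last window, along which
   X_k is close to xlim t0. The semiflow takes this bounded set close to A in time
   T, hence the points (g . tau_k, xlim t0, Y_k (tau_k)) approach A, which is (i).
   Compactness of A gives the rest: the infimum delta_k is attained, and the
   sections of A are upper semicontinuous. *)

Require Import Defs.
From HB Require Import structures.
From mathcomp Require Import all_boot all_order all_algebra.
From mathcomp Require Import all_classical all_reals all_analysis.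
From mathcomp Require Import ring lra.

Set Implicit Arguments.
Unset Strict Implicit.
Unset Printing Implicit Defensive.

Import Order.TTheory GRing.Theory Num.Theory.
Import numFieldNormedType.Exports.

Local Open Scope classical_set_scope.
Local Open Scope ring_scope.

(** * Euclidean norm and solutions on intervals *)

Lemma norm_le_eunorm (R : realType) (n : nat) (x : 'rV[R]_n) : `|x| <= eunorm x.
Proof.
rewrite [leLHS]mx_normrE; apply/bigmax_leP; split=> [|[i j] _ /=].
  exact: sqrtr_ge0.
rewrite ord1 -sqrtr_sqr ler_sqrt; last by apply: sumr_ge0 => k _; exact: sqr_ge0.
by rewrite (bigD1 j) //= lerDl; apply: sumr_ge0 => k _; exact: sqr_ge0.
Qed.

Lemma norm_entry_le (R : realType) (n : nat) (x : 'rV[R]_n) (j : 'I_n) :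
  `|x 0 j| <= `|x|.
Proof.
by rewrite [leRHS]mx_normrE; apply/bigmax_geP; right; exists (0, j).
Qed.

(** The crude factor [n.+1] in place of $\sqrt n$ is positive even for [n = 0], so errors can be
    divided by it. *)
Lemma eunorm_le_norm (R : realType) (n : nat) (x : 'rV[R]_n) :
  eunorm x <= n.+1%:R * `|x|.
Proof.
have nx0 : 0 <= n.+1%:R * `|x| by rewrite mulr_ge0.
rewrite -[leRHS](ger0_norm nx0) -sqrtr_sqr ler_sqrt ?sqr_ge0//.
have : \sum_(i < n) x 0 i ^+ 2 <= \sum_(i < n) `|x| ^+ 2.
  apply: ler_sum => i _; rewrite -[leLHS]real_normK ?num_real//.
  by rewrite lerXn2r ?nnegrE ?norm_entry_le.
move/le_trans; apply; rewrite sumr_const card_ord exprMn -[leLHS]mulr_natl.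
rewrite ler_wpM2r ?sqr_ge0// -natrX ler_nat.
by rewrite (leq_trans (leqnSn n))// -[leqLHS]muln1 leq_mul.
Qed.

Lemma within_dnbhs_within (R : realType) (V : normedModType R) (I : set R)
    (u : R -> V) (t : R) :
  u s @[s --> within I t^'] --> u t -> u s @[s --> within I (nbhs t)] --> u t.
Proof.
move=> ut A At; have H := ut _ At.
suff : nbhs t (fun s => I s -> A (u s)) by [].
have {}H : nbhs t (fun s => s != t -> I s -> A (u s)) by exact: H.
apply: filterS H => s Hs Is; have [->|st] := eqVneq s t; last exact: Hs.
exact: nbhs_singleton.
Qed.

(** Multiplying the difference quotient by [s - t], which tends to 0, recovers the increment of
    [u]. *)
Lemma derivative_within_continuous (R : realType) (V : normedModType R)
    (I : set R) (u : R -> V) (t : R) (v : V) :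
  derivative_within I u t v -> u s @[s --> within I (nbhs t)] --> u t.
Proof.
move=> uv; apply: within_dnbhs_within.
have h : (s - t) *: ((s - t)^-1 *: (u s - u t)) + u t
    @[s --> within I t^'] --> (0 : R) *: v + u t.
  apply: cvgD; last exact: cvg_cst.
  apply: cvgZ; last exact: uv.
  rewrite -(subrr t); apply: cvgB; last exact: cvg_cst.
  move=> A tA; suff : nbhs t (fun s => s != t -> I s -> A s) by [].
  by apply: filterS tA.
move: h; rewrite scale0r add0r; apply: cvg_trans; apply: near_eq_cvg.
suff : nbhs t (fun s => s != t -> I s ->
    (s - t) *: ((s - t)^-1 *: (u s - u t)) + u t = u s) by [].
apply: filterE => s st _.
by rewrite scalerA divff ?scale1r ?subrK// subr_eq0.
Qed.

Lemma solves_on_continuous (R : realType) (V : normedModType R)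
    (I : set R) (F : R -> V -> V) (u : R -> V) :
  solves_on I F u -> {within I, continuous u}.
Proof.
move=> uF; apply/subspace_continuousP => t It.
exact: derivative_within_continuous (uF t It).
Qed.

Lemma solves_on_subset (R : realType) (V : normedModType R)
    (I J : set R) (F : R -> V -> V) (u : R -> V) :
  J `<=` I -> solves_on I F u -> solves_on J F u.
Proof.
move=> JI uF t Jt; apply: cvg_trans (uF t (JI _ Jt)).
apply: cvg_app => A; rewrite /within /= /nbhs /=.
by apply: filterS => s As /JI.
Qed.

Lemma solves_on_ext (R : realType) (V : normedModType R)
    (I : set R) (F G : R -> V -> V) (u : R -> V) :
  (forall t, I t -> F t (u t) = G t (u t)) -> solves_on I F u -> solves_on I G u.
Proof. by move=> FG uF t It; rewrite -FG//; exact: uF. Qed.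

(** Chain rule for an affine change of time. With [c = eps k] it passes from slow to fast time; with
    [c = 1] it is a translation. *)
Lemma solves_on_affine (R : realType) (V : normedModType R)
    (I J : set R) (F : R -> V -> V) (u : R -> V) (c s : R) :
  0 < c -> (forall t, J t -> I (c * (t + s))) -> solves_on I F u ->
  solves_on J (fun t y => c *: F (c * (t + s)) y) (fun t => u (c * (t + s))).
Proof.
move=> c0 JI uF t Jt; have {}uF := uF _ (JI _ Jt).
have cE p : (p - t)^-1 *: (u (c * (p + s)) - u (c * (t + s))) =
    c *: ((c * (p + s) - c * (t + s))^-1 *: (u (c * (p + s)) - u (c * (t + s)))).
  rewrite scalerA; congr (_ *: _).
  have -> : c * (p + s) - c * (t + s) = c * (p - t) by ring.
  by rewrite invfM mulrA divff ?mul1r ?gt_eqF.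
rewrite /derivative_within (eq_cvg _ _ cE).
apply: cvgZ; first exact: cvg_cst.
apply: (@cvg_comp _ _ _ (fun p => c * (p + s))
  (fun q => (q - c * (t + s))^-1 *: (u q - u (c * (t + s))))); last exact: uF.
move=> A At.
have {}At : nbhs (c * (t + s)) (fun q => q != c * (t + s) -> I q -> A q).
  exact: At.
suff : nbhs t (fun p => p != t -> J p -> A (c * (p + s))) by [].
have cc : (c * (p + s)) @[p --> t] --> c * (t + s).
  by apply: cvgM; [exact: cvg_cst|apply: cvgD; [exact: cvg_id|exact: cvg_cst]].
have {}At : \forall p \near t,
    c * (p + s) != c * (t + s) -> I (c * (p + s)) -> A (c * (p + s)).
  exact: cc _ At.
apply: filterS At => p Ap pt Jp; apply: Ap; last exact: JI.
by rewrite (inj_eq (mulfI (lt0r_neq0 c0))) (inj_eq (addIr _)).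
Qed.

(** An argument at a first contact time looks only at earlier times, and the left quotient also
    makes sense at the endpoint [b]. *)
Lemma derivative_within_left (R : realType) (V : normedModType R)
    (a b : R) (u : R -> V) (t : R) (v : V) :
  a < t <= b -> derivative_within `[a, b] u t v ->
  (s - t)^-1 *: (u s - u t) @[s --> t^'-] --> v.
Proof.
move=> /andP[a_t tb] uv A Av.
have {}Av : \forall s \near t, s != t -> `[a, b]%classic s ->
    A ((s - t)^-1 *: (u s - u t)) by exact: uv _ Av.
suff : \forall s \near t, s < t -> A ((s - t)^-1 *: (u s - u t)) by [].
near=> s => st; have : `[a, b]%classic s.
  rewrite /= in_itv /=; apply/andP; split; last exact: le_trans (ltW st) tb.
  by near: s; exact: lt_le_nbhsr.
have : s != t by rewrite lt_eqF.
by near: s.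
Unshelve. all: by end_near. Qed.

Lemma subspace_cvg_left (R : realType) (V : topologicalType)
    (a b : R) (u : R -> V) (t : R) :
  a < t <= b -> {within `[a, b], continuous u} -> u s @[s --> t^'-] --> u t.
Proof.
move=> /andP[a_t tb] /subspace_continuousP uc A At.
have It : `[a, b]%classic t by rewrite /= in_itv /= ltW.
have {}At : \forall s \near t, `[a, b]%classic s -> A (u s) by exact: uc It _ At.
suff : \forall s \near t, s < t -> A (u s) by [].
near=> s => st; have : `[a, b]%classic s.
  rewrite /= in_itv /=; apply/andP; split; last exact: le_trans (ltW st) tb.
  by near: s; exact: lt_le_nbhsr.
by near: s.
Unshelve. all: by end_near. Qed.

(* A barrier argument: at the first time when [|v - u|] meets
   [beta * expR ((L + 1) * t)], the left difference quotients of [v - u] are at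
   least [L + 1] times the barrier, whereas [|v' - u'|] is strictly smaller. *)
Lemma solves_on_comparison (R : realType) (V : normedModType R)
    (F G : R -> V -> V) (u v : R -> V) (T L eta beta : R) :
  0 <= L -> eta < beta -> beta * expR ((L + 1) * T) <= 1 ->
  solves_on `[0, T] F u -> solves_on `[0, T] G v ->
  (forall t w, 0 <= t <= T -> `|w - u t| <= 1 ->
    `|G t w - F t (u t)| <= L * `|w - u t| + eta) ->
  `|v 0 - u 0| < beta ->
  forall t, 0 <= t <= T -> `|v t - u t| < beta * expR ((L + 1) * t).
Proof.
move=> L0 etab bT uF vG FG uv0 t1 t1T.
have beta0 : 0 < beta by exact: le_lt_trans uv0.
pose b t := beta * expR ((L + 1) * t); pose w t := v t - u t.
rewrite -/(b _) -/(w _) ltNge; apply/negP => bw1.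
have bc : continuous b.
  move=> t; apply: cvgM; first exact: cvg_cst.
  apply: (@cvg_comp _ _ _ (fun t => (L + 1) * t) expR); last exact: continuous_expR.
  by apply: cvgM; [exact: cvg_cst|exact: cvg_id].
have wc : {within `[0, T], continuous w}.
  move=> t; apply: cvgB; first exact: (solves_on_continuous vG).
  exact: (solves_on_continuous uF).
pose S := [set t | 0 <= t <= T /\ b t <= `|w t|].
have St1 : S t1 by [].
have hS : has_inf S by split; [exists t1|exists 0 => t [/andP[]]].
pose t := inf S.
have t0 : 0 <= t by apply: lb_le_inf => [|s [/andP[]]//]; exists t1.
have tT : t <= T by apply: le_trans (ge_inf hS.2 St1) _; case/andP: t1T.
have It : `[0, T]%classic t by rewrite /= in_itv /= t0.
(* The infimum is attained: a strict inequality at [t] would persist on [0, T] near [t], where [S]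
   has points. *)
have wt : b t <= `|w t|.
  rewrite leNgt; apply/negP => wb.
  have /subspace_continuousP/(_ t It) wct := wc.
  have : \forall s \near t, `[0, T]%classic s -> `|w s| < b s.
    have wbc : `|w s| - b s @[s --> within `[0, T] (nbhs t)] --> `|w t| - b t.
      apply: cvgB; first by apply: cvg_norm; exact: wct.
      by apply: cvg_within_filter; exact: bc.
    have wb0 : nbhs (`|w t| - b t) [set x | x < 0].
      by apply: lt_nbhsl; rewrite subr_lt0.
    have : \forall s \near t, `[0, T]%classic s -> `|w s| - b s < 0.
      exact: wbc _ wb0.
    by apply: filterS => s /[apply]; rewrite subr_lt0.
  case/nbhs_ballP => e /= e0 be.
  have [s Ss se] := inf_adherent e0 hS.
  have ts : t <= s by exact: (ge_inf hS.2 Ss).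
  case: Ss => sT; rewrite leNgt => /negP; apply; apply: be.
    by rewrite /ball /= ler0_norm ?subr_le0// opprB ltrBlDl.
  by rewrite /= in_itv.
have tgt0 : 0 < t.
  rewrite lt_neqAle t0 andbT; apply/eqP => t0E; move: wt.
  by rewrite -t0E /b mulr0 expR0 mulr1 leNgt uv0.
have tI : 0 < t <= T by rewrite tgt0.
have wlt s : 0 <= s -> s < t -> `|w s| < b s.
  move=> s0 st; rewrite ltNge; apply/negP => bs.
  have Ss : S s by split=> //; rewrite s0 /= (le_trans (ltW st)).
  by have := ge_inf hS.2 Ss; rewrite leNgt st.
have bl : b s @[s --> t^'-] --> b t by exact: cvg_at_left_filter (bc t).
have wl : `|w s| @[s --> t^'-] --> `|w t|.
  by apply: cvg_norm; exact: subspace_cvg_left tI wc.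
have wbt : `|w t| <= b t.
  apply: ler_cvg_to wl bl _; near=> s; apply/ltW/wlt; last by near: s; exact: nbhs_left_lt.
  by near: s; exact: nbhs_left_ge.
(* As the barrier stays below 1, [v t] lies in the range where [FG] applies. *)
have bt1 : b t <= 1.
  apply: le_trans bT; rewrite ler_pM2l// ler_expR ler_pM2l//.
  by rewrite ltr_wpDl.
have : (s - t)^-1 *: (w s - w t) @[s --> t^'-] --> G t (v t) - F t (u t).
  have qE s : (s - t)^-1 *: (w s - w t) =
      (s - t)^-1 *: (v s - v t) - (s - t)^-1 *: (u s - u t).
    by rewrite -scalerBr /w !opprB [u t - v t]addrC addrACA [- u s + _]addrC.
  rewrite (eq_cvg _ _ qE); apply: cvgB; apply: derivative_within_left tI _.
    exact: vG.
  exact: uF.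
move=> /cvg_norm wq.
have bq : (L + 1) * b s @[s --> t^'-] --> (L + 1) * b t.
  by apply: cvgM; [exact: cvg_cst|].
have : (L + 1) * b t <= `|G t (v t) - F t (u t)|.
  apply: ler_cvg_to bq wq _; near=> s.
  have st : s < t by near: s; exact: nbhs_left_lt.
  have s0 : 0 <= s by near: s; exact: nbhs_left_ge.
  rewrite normrZ normfV ltr0_norm ?subr_lt0// opprB [leRHS]mulrC ler_pdivlMr ?subr_gt0//.
  have : b t - b s <= `|w s - w t|.
    rewrite distrC; apply: le_trans (lerB_dist _ _).
    by apply: lerB => //; exact/ltW/wlt.
  apply: le_trans.
  (* Since $e^z \ge 1 + z$, the barrier grows from [s] to [t] by at least
     [(L + 1) * (t - s) * b s]. *)
  have -> : b t = b s * expR ((L + 1) * (t - s)).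
    by rewrite /b -mulrA -expRD -mulrDr addrCA subrr addr0.
  have bs0 : 0 < b s by rewrite mulr_gt0 ?expR_gt0.
  have := expR_ge1Dx ((L + 1) * (t - s)).
  by rewrite -(ler_pM2l bs0) => ?; lra.
(* Contradiction: [(L + 1) * b t] would be at most [L * b t + eta], although [eta < beta <= b t]. *)
have := FG t (v t); rewrite t0 tT (le_trans wbt bt1) -/(w t) => /(_ isT isT).
have eb : eta < b t.
  apply: lt_le_trans etab _; rewrite ler_peMr ?ltW// -expR0 ltr_expR mulr_gt0//.
  by rewrite ltr_wpDl.
have Lw : L * `|w t| <= L * b t by rewrite ler_wpM2l.
lra.
Unshelve. all: by end_near. Qed.

(** * Closed balls, and the hypotheses on [g] in the sup norm *)

Definition clball (R : realType) (n : nat) (M : R) : set 'rV[R]_n :=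
  [set x | `|x| <= M].

Lemma compact_clball (R : realType) (n : nat) (M : R) : compact (@clball R n M).
Proof.
apply: bounded_closed_compact.
  exists M; split; first exact: num_real.
  by move=> N MN x /le_trans; apply; exact: ltW.
exact: (closed_comp (fun x _ => @norm_continuous _ _ x) (@closed_le _ M)).
Qed.

Lemma compact_clballX (R : realType) (n m : nat) (M N : R) :
  compact (@clball R n M `*` @clball R m N).
Proof. by apply: compact_setX; exact: compact_clball. Qed.

Section SupNorm.
Context {R : realType} {n m : nat} (g : pfield R n m).

Lemma admissible_bounded (M : R) : admissible g ->
  exists B : R, forall x y s, `|x| <= M -> `|y| <= M -> `|g (x, y, s)| <= B.
Proof.
move=> /(_ (clball M `*` clball M) (@compact_clballX R n m M M)).
case=> -[B gB] _; exists B => x y s xM yM; apply: le_trans (norm_le_eunorm _) _.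
exact: gB.
Qed.

Lemma admissible_unif_continuous (M e : R) : admissible g -> 0 < e ->
  exists2 eta : R, 0 < eta & forall x x' y y' s s',
    `|x| <= M -> `|x'| <= M -> `|y| <= M -> `|y'| <= M ->
    `|x - x'| < eta -> `|y - y'| < eta -> `|s - s'| < eta ->
    `|g (x, y, s) - g (x', y', s')| < e.
Proof.
move=> /(_ (clball M `*` clball M) (@compact_clballX R n m M M)).
case=> _ H e0; have [eta eta0 gc] := H _ e0.
(* A common factor for the norm comparisons in both dimensions; being at least 1, it also serves the
   time variable. *)
pose N : R := (maxn n m).+1%:R.
have N0 : 0 < N by rewrite ltr0n.
have nN : n.+1%:R <= N by rewrite ler_nat ltnS leq_maxl.
have mN : m.+1%:R <= N by rewrite ler_nat ltnS leq_maxr.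
have N1 : 1 <= N by rewrite ler1n.
exists (eta / N); first by rewrite divr_gt0.
move=> x x' y y' s s' xM xM' yM yM'.
rewrite !ltr_pdivlMr// => xx yy ss.
apply: le_lt_trans (norm_le_eunorm _) _; apply: gc => //=.
- apply: le_lt_trans (eunorm_le_norm _) _; apply: le_lt_trans xx.
  by rewrite mulrC ler_wpM2l.
- apply: le_lt_trans (eunorm_le_norm _) _; apply: le_lt_trans yy.
  by rewrite mulrC ler_wpM2l.
- by apply: le_lt_trans ss; rewrite ler_peMr.
Qed.

Lemma lipschitz_in_y_norm (M : R) : lipschitz_in_y g ->
  exists2 L : R, 0 <= L & forall x y y' s,
    `|x| <= M -> `|y| <= M -> `|y'| <= M ->
    `|g (x, y, s) - g (x, y', s)| <= L * `|y - y'|.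
Proof.
move=> /(_ (clball M) (clball M) (@compact_clball R n M) (@compact_clball R m M))[L gL].
exists (`|L| * m.+1%:R) => [|x y y' s xM yM yM']; first exact: mulr_ge0.
apply: le_trans (norm_le_eunorm _) _; apply: le_trans (gL x y y' s xM yM yM') _.
rewrite -mulrA (le_trans (ler_wpM2r (sqrtr_ge0 _) (ler_norm L)))//.
by rewrite ler_wpM2l// eunorm_le_norm.
Qed.

End SupNorm.

(** * Compactness of the hull *)

(** Along an ultrafilter every cluster point is a limit. This takes the place of extracting
    subsequences. *)
Lemma ultra_cvg_compact (I : Type) (T : topologicalType) (U : set_system I)
    (f : I -> T) (K : set T) :
  UltraFilter U -> compact K -> (forall i, K (f i)) ->
  exists2 l, K l & f i @[i --> U] --> l.
Proof.
move=> UU cK fK; have UK : U (f @^-1` K) by apply: filterE.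
have [l [Kl clUl]] := cK (f @ U) _ UK; exists l => // N lN.
have [//|UnN] := in_ultra_setVsetC (f @^-1` N) UU.
by have [x [nNx Nx]] := clUl (~` N) N UnN lN.
Qed.

Section HullLimits.
Context {R : realType} {n m : nat} (g : pfield R n m).
Hypothesis hg : admissible g.

(** The modulus of continuity of an admissible field is uniform in time, so it serves all translates
    at once. *)
Lemma translate_equicontinuous (p : 'rV[R]_n * 'rV[R]_m * R) (e : R) : 0 < e ->
  \forall q \near p, forall s, `|translate g s p - translate g s q| < e.
Proof.
case: p => [[x y] t] e0; pose M := `|x| + `|y| + 1.
have [eta eta0 geta] := admissible_unif_continuous M hg e0.
apply/nbhs_ballP; exists (Num.min eta 1) => /=; first by rewrite lt_min eta0 ltr01.
move=> [[x' y'] t'] [/= [xx' yy'] tt'] s.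
move: xx' yy' tt'; rewrite -!ball_normE /ball_ /= !lt_min.
move=> /andP[xe x1] /andP[ye y1] /andP[te t1]; rewrite /translate /=.
have x'1 : `|x'| <= `|x| + `|x - x'|.
  by rewrite -[in leLHS](subKr x x') (le_trans (ler_normB _ _)).
have y'1 : `|y'| <= `|y| + `|y - y'|.
  by rewrite -[in leLHS](subKr y y') (le_trans (ler_normB _ _)).
have ? := normr_ge0 x; have ? := normr_ge0 y.
apply: geta => //; rewrite /M; try lra.
by rewrite opprD addrACA subrr addr0.
Qed.

Lemma translate_continuous (s : R) :
  continuous (translate g s : 'rV[R]_n * 'rV[R]_m * R -> 'rV[R]_m).
Proof.
move=> p; apply/cvgrPdist_lt => e e0.
by apply: filterS (translate_equicontinuous p e0) => q; exact.
Qed.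

Lemma hull_translate (s : R) : hull g (translate g s).
Proof.
by split; [apply: subset_closure; exists s|exact: translate_continuous].
Qed.

(** Compactness of the hull in ultrafilter form. Boundedness gives pointwise limits; equicontinuity
    makes the limit joint in the point and the index, whence continuity of [h] and convergence in
    the compact-open topology. The joint form also allows moving arguments. *)
Lemma hull_ultralimit (U : set_system nat) (s : nat -> R) : UltraFilter U ->
  exists2 h, hull g h & forall p e, 0 < e ->
    \forall q \near p & k \near U, `|h p - translate g (s k) q| < e.
Proof.
move=> UU.
have hex : forall p, exists l : 'rV[R]_m, translate g (s k) p @[k --> U] --> l.
  move=> [[x y] t]; have [B gB] := admissible_bounded (`|x| + `|y|) hg.
  have [k|l _ gl] := ultra_cvg_compact UU (@compact_clball R m B)
      (f := fun k => translate g (s k) (x, y, t)); last by exists l.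
  by apply: gB; rewrite ?lerDl ?lerDr.
have [h gh] := choice hex; have joint p e : 0 < e ->
    \forall q \near p & k \near U, `|h p - translate g (s k) q| < e.
  move=> e0; have e20 : 0 < e / 2 by rewrite divr_gt0.
  have ghp : \forall k \near U, `|h p - translate g (s k) p| < e / 2.
    exact: cvgr_dist_lt (gh p) _ e20.
  near=> q k.
  have /(_ (s k)) gq : forall s, `|translate g s p - translate g s q| < e / 2.
    by near: q; exact: translate_equicontinuous.
  have hk : `|h p - translate g (s k) p| < e / 2 by near: k.
  have := ler_distD (translate g (s k) p) (h p) (translate g (s k) q).
  lra.
have hc : continuous (h : 'rV[R]_n * 'rV[R]_m * R -> 'rV[R]_m).
  move=> p; apply/cvgrPdist_lt => e e0.
  have e30 : 0 < e / 3 by rewrite divr_gt0.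
  apply: filterS (translate_equicontinuous p e30) => q gq.
  have [k [hk1 hk2]] : exists k, `|h p - translate g (s k) p| < e / 3 /\
      `|h q - translate g (s k) q| < e / 3.
    apply: (@filter_ex _ U); apply: filterI.
      exact: cvgr_dist_lt (gh p) _ e30.
    exact: cvgr_dist_lt (gh q) _ e30.
  have := gq (s k); rewrite distrC in hk2.
  have := ler_distD (translate g (s k) p) (h p) (h q).
  have := ler_distD (translate g (s k) q) (translate g (s k) p) (h q).
  lra.
exists h => //; split=> //.
suff gU : {compact-open, translate g (s k) @[k --> U] --> h}.
  move=> W hW; have [k Wk] : exists k, W (translate g (s k)).
    by apply: (@filter_ex _ U); exact: gU.
  by exists (translate g (s k)); split => //; exists (s k).
apply/compact_open_cvgP => K O cK oO hKO.
(* Compactness of [K] turns a joint statement near each of its points into one that is uniform over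
   [K]. *)
have /near_covering_withinP := (compact_near_coveringP K).1 cK.
move=> /(_ _ U (fun k p => O (translate g (s k) p))).
suff : forall p, K p -> \forall q \near p & k \near U, K q -> O (translate g (s k) q).
  move=> H /(_ _ H); apply: filterS => k KO _ [q Kq <-]; exact: KO.
move=> p Kp; have /nbhs_normP[e /= e0 eO] : nbhs (h p) O.
  by apply: open_nbhs_nbhs; split=> //; apply: hKO; exists p.
apply: filterS (joint p e e0) => -[q k] /= hq Kq; exact: eO.
Unshelve. all: by end_near. Qed.

End HullLimits.

(** * Uniform estimates on bounded time intervals *)

Section FiniteHorizon.
Context {R : realType} {n m : nat} (g : pfield R n m).
Hypotheses (hg : admissible g) (hgL : lipschitz_in_y g).

(* A sequence of solutions blowing up on [0, T] would converge, along an
   ultrafilter, to a solution of a field of the hull, which is bounded on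
   [0, T]: this is where global existence over the whole hull is needed. *)
Lemma frozen_solutions_bounded (M rho T : R) :
  (forall h x y, hull g h -> forward_solution h x 0 y !=set0) ->
  0 <= T ->
  exists N : R, forall s x u, `|x| <= M -> `|u 0| <= rho ->
    solves_on `[0, T] (fun t y => g (x, y, t + s)) u ->
    forall t, 0 <= t <= T -> `|u t| <= N.
Proof.
move=> hglob T0; apply: contrapT => /forallNP unbdd.
pose bad (N : R) (q : R * 'rV[R]_n * (R -> 'rV[R]_m) * R) :=
  [/\ `|q.1.1.2| <= M, `|q.1.2 0| <= rho,
    solves_on `[0, T] (fun t y => g (q.1.1.2, y, t + q.1.1.1)) q.1.2,
    0 <= q.2 <= T & N < `|q.1.2 q.2|].
have badex : forall k : nat, exists q, bad k%:R q.
  move=> k; apply: contrapT => nbad; apply: (unbdd k%:R) => s x u xM u0 us t tT.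
  by rewrite leNgt; apply/negP => kut; apply: nbad; exists (s, x, u, t).
have [q qbad] := choice badex.
(* One ultrafilter refining the tails makes parameters, initial values and translated fields
   converge simultaneously. *)
have [U [UU ooU]] := ultraFilterLemma (eventually_filter : ProperFilter \oo).
have [x _ xq] := ultra_cvg_compact UU (@compact_clball R n M)
  (f := fun k => (q k).1.1.2) (fun k => let: And5 h _ _ _ _ := qbad k in h).
have [y _ yq] := ultra_cvg_compact UU (@compact_clball R m rho)
  (f := fun k => (q k).1.2 0) (fun k => let: And5 _ h _ _ _ := qbad k in h).
have [h hh hq] := hull_ultralimit hg (fun k => (q k).1.1.1) UU.
have [v [v0 /(@solves_on_subset _ _ _ `[0, T]) vs]] := hglob h x y hh.
have {}vs : solves_on `[0, T] (fun t y => h (x, y, t)) v.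
  by apply: vs => t; rewrite /= !in_itv /= => /andP[->].
have vc := solves_on_continuous vs.
have [N0 N00 vN0] : exists2 N0, 0 < N0 & forall t, 0 <= t <= T -> `|v t| < N0.
  have /ex_strict_bound_gt0[N0 N00 vN0] : bounded_set (v @` `[0, T]).
    apply: compact_bounded; apply: continuous_compact vc _.
    exact: segment_compact.
  exists N0 => // t tT; by apply: vN0; exists t => //=; rewrite in_itv.
(* This ball contains the parameters and all points within 1 of [v], so a single Lipschitz constant
   suffices. *)
pose M1 := `|M| + N0 + 1.
have [L L0 gL] := lipschitz_in_y_norm M1 hgL.
(* Chosen so that the barrier of the comparison lemma reaches exactly 1 at time [T]. *)
pose beta := expR (- ((L + 1) * T)).
have beta0 : 0 < beta by exact: expR_gt0.
have betaT : beta * expR ((L + 1) * T) = 1 by rewrite -expRD addNr expR0.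
(* Near each [t] the joint limit and the continuity of [h] and [v] give the estimate; compactness of
   [0, T] makes it uniform in [t]. *)
have near_h : \forall k \near U, forall t, `[0, T]%classic t ->
    `|h (x, v t, t) - g ((q k).1.1.2, v t, t + (q k).1.1.1)| < beta / 2.
  have /compact_near_coveringP/near_covering_withinP cT := @segment_compact R 0 T.
  apply: (cT _ U (fun k t => `|h (x, v t, t) -
    g ((q k).1.1.2, v t, t + (q k).1.1.1)| < beta / 2)) => t tT.
  have b40 : 0 < beta / 2 / 2 by rewrite !divr_gt0.
  have hc : \forall p \near (x, v t, t), `|h (x, v t, t) - h p| < beta / 2 / 2.
    by case: hh => _ /(_ (x, v t, t)) hc; exact: cvgr_dist_lt hc _ b40.
  have [[A B] /= [pA UB] AB] := hq (x, v t, t) _ b40.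
  have /nbhs_ballP[e /= e0 eA] : nbhs (x, v t, t)
      (A `&` [set p | `|h (x, v t, t) - h p| < beta / 2 / 2]).
    exact: filterI.
  have xe : \forall k \near U, ball x e (q k).1.1.2 by exact: xq _ (nbhsx_ballx _ _ e0).
  have /subspace_continuousP/(_ t tT)/(_ _ (nbhsx_ballx _ _ e0)) vte := vc.
  have {}vte : \forall r \near t, `[0, T]%classic r -> ball (v t) e (v r) by exact: vte.
  near=> r k => rT; have {}rT : `[0, T]%classic r by exact: rT.
  have br : ball t e r by near: r; exact: (nbhsx_ballx _ _ e0).
  have bv : ball (v t) e (v r).
    move: rT; near: r. exact: vte.
  have bx : ball x e (q k).1.1.2 by near: k.
  have [] := eA ((q k).1.1.2, v r, r).
    by [].
  have [|_ /= h2] := eA (x, v r, r).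
    by split=> //; split => //; exact: ballxx.
  move=> /(fun h => AB (_, k) (conj h _)) /= h1 _.
  have {h1} : `|h (x, v t, t) - translate g (q k).1.1.1 ((q k).1.1.2, v r, r)| < beta / 2 / 2.
    by apply: h1; near: k.
  rewrite /translate /=.
  have := ler_distD (h (x, v t, t)) (h (x, v r, r)) (g ((q k).1.1.2, v r, r + (q k).1.1.1)).
  rewrite distrC in h2; lra.
(* For such a [k] the comparison keeps the bad solution within 1 of [v], hence below [N0 + 1 <= k],
   against its choice. *)
have [k [hk yk kN]] : exists k, [/\ forall t, `[0, T]%classic t ->
      `|h (x, v t, t) - g ((q k).1.1.2, v t, t + (q k).1.1.1)| < beta / 2,
      `|y - (q k).1.2 0| < beta & N0 + 1 <= k%:R].
  apply: (@filter_ex _ U); near=> k; split; near: k => //.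
    exact: cvgr_dist_lt yq _ beta0.
  by apply: ooU; exact: nbhs_infty_ger.
case: (qbad k); set s := (q k).1.1.1; set xk := (q k).1.1.2; set u := (q k).1.2.
set t := (q k).2 => xkM u0 us tT; apply/negP; rewrite -leNgt.
have Mle : M <= `|M| by exact: ler_norm.
have Mge : 0 <= `|M| by [].
have : `|u t - v t| < beta * expR ((L + 1) * t).
  apply: (solves_on_comparison (eta := beta / 2) L0 _ _ vs us) tT.
  - by rewrite ltr_pdivrMr// ltr_pMr// ltr1n.
  - by rewrite betaT.
  - move=> r w rT wv; have vN := vN0 r rT.
    have wN : `|w| <= `|v r| + 1.
      by rewrite -[w in leLHS](subrK (v r)) (le_trans (ler_normD _ _))// addrC lerD2l.
    have : `|g (xk, w, r + s) - g (xk, v r, r + s)| <= L * `|w - v r|.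
      by apply: gL; rewrite /M1; lra.
    have : `|h (x, v r, r) - g (xk, v r, r + s)| < beta / 2.
      by apply: hk; rewrite /= in_itv.
    rewrite distrC; have := ler_distD (g (xk, v r, r + s)) (g (xk, w, r + s)) (h (x, v r, r)).
    lra.
  - by rewrite v0 distrC.
have : beta * expR ((L + 1) * t) <= 1.
  rewrite -[leRHS]betaT ler_pM2l// ler_expR ler_wpM2l ?addr_ge0//.
  by case/andP: tT.
have := vN0 t tT; have := ler_normD (u t - v t) (v t); rewrite subrK.
lra.
Unshelve. all: by end_near. Qed.

Lemma moving_frozen_close (M rho T e : R) :
  (forall h x y, hull g h -> forward_solution h x 0 y !=set0) ->
  0 <= T -> 0 < e ->
  exists2 delta : R, 0 < delta & forall s X x u v t1, `|x| <= M -> t1 <= T ->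
    (forall t, 0 <= t <= t1 -> `|X t| <= M /\ `|X t - x| <= delta) ->
    `|u 0| <= rho -> v 0 = u 0 ->
    solves_on `[0, T] (fun t y => g (x, y, t + s)) u ->
    solves_on `[0, t1] (fun t y => g (X t, y, t + s)) v ->
    forall t, 0 <= t <= t1 -> `|v t - u t| <= e.
Proof.
move=> hglob T0 e0; have [N uN] := frozen_solutions_bounded M rho hglob T0.
pose M1 := `|M| + `|N| + 1.
have [L L0 gL] := lipschitz_in_y_norm M1 hgL.
(* The barrier ends at [Num.min e 1]: at most [e] for the conclusion, at most 1 for the
   comparison. *)
pose beta := Num.min e 1 * expR (- ((L + 1) * T)).
have beta0 : 0 < beta by rewrite mulr_gt0 ?expR_gt0// lt_min e0 ltr01.
have betaT : beta * expR ((L + 1) * T) = Num.min e 1.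
  by rewrite -mulrA -expRD addNr expR0 mulr1.
have b20 : 0 < beta / 2 by rewrite divr_gt0.
have [delta delta0 gd] := admissible_unif_continuous M1 hg b20.
(* Halving turns the non-strict closeness of the parameters into the strict one that the modulus
   [gd] asks for. *)
exists (delta / 2); first by rewrite divr_gt0.
move=> s X x u v t1 xM t1T Xx u0 vu us vs t tt1.
have Mle : M <= `|M| by exact: ler_norm.
have Nle : N <= `|N| by exact: ler_norm.
have Mge : 0 <= `|M| by [].
have Nge : 0 <= `|N| by [].
suff : `|v t - u t| < beta * expR ((L + 1) * t).
  move/ltW/le_trans; apply; apply: (@le_trans _ _ (Num.min e 1)); last first.
    by rewrite ge_min lexx.
  rewrite -[leRHS]betaT ler_pM2l// ler_expR ler_wpM2l ?addr_ge0//.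
  by case/andP: tt1 => _ /le_trans; exact.
have it1 : `[0, t1] `<=` `[0, T].
  by move=> r /=; rewrite !in_itv /= => /andP[-> /le_trans]; exact.
apply: (solves_on_comparison (eta := beta / 2) L0 _ _ (solves_on_subset it1 us) vs) tt1.
- by rewrite ltr_pdivrMr// ltr_pMr// ltr1n.
- apply: (@le_trans _ _ (Num.min e 1)); last by rewrite ge_min lexx orbT.
  by rewrite -betaT ler_pM2l// ler_expR ler_wpM2l ?addr_ge0.
- move=> r w rt1 wu; have [r0 rle] := andP rt1.
  have rT : 0 <= r <= T by rewrite r0 (le_trans rle).
  have uNr := uN s x u xM u0 us r rT.
  have wN : `|w| <= `|u r| + 1.
    by rewrite -[w in leLHS](subrK (u r)) (le_trans (ler_normD _ _))// addrC lerD2l.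
  have [XM Xd] := Xx r rt1.
  have : `|g (X r, w, r + s) - g (X r, u r, r + s)| <= L * `|w - u r|.
    by apply: gL; rewrite /M1; lra.
  have : `|g (X r, u r, r + s) - g (x, u r, r + s)| < beta / 2.
    by apply: gd; rewrite ?subrr ?normr0 /M1//; lra.
  have := ler_distD (g (X r, u r, r + s)) (g (X r, w, r + s)) (g (x, u r, r + s)).
  lra.
- by rewrite vu subrr normr0.
Qed.

End FiniteHorizon.

(** * The fast system *)

Lemma uniform_cvg_on_dist (R : realType) (V : normedModType R) (I : set R)
    (u : nat -> R -> V) (l : R -> V) (e : R) :
  {uniform I, u k @[k --> \oo] --> l} -> 0 < e ->
  \forall k \near \oo, forall t, I t -> `|u k t - l t| < e.
Proof.
move=> ul e0.
have : nbhs (l : {uniform` I -> V}) [set h | forall t, I t -> `|h t - l t| < e].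
  rewrite uniform_nbhs; exists [set p | ball p.1 e p.2]; split.
    exact: (entourage_ball _ (PosNum e0)).
  move=> h /= lh t It; have := lh t It.
  by rewrite -ball_normE /ball_ /= distrC.
by move=> /ul; exact.
Qed.

(** Heine-Cantor theorem for a map that is continuous relative to the segment. *)
Lemma within_itv_unif_continuous (R : realType) (V : normedModType R)
    (a b e : R) (u : R -> V) :
  {within `[a, b], continuous u} -> 0 < e ->
  exists2 eta : R, 0 < eta & forall s t, a <= s <= b -> a <= t <= b ->
    `|s - t| < eta -> `|u s - u t| < e.
Proof.
move=> uc e0.
have /compact_near_coveringP/near_covering_withinP cab := @segment_compact R a b.
have : \forall eta \near (0 : R)^'+, `[a, b]%classic `<=` [set s | forall t,
    a <= t <= b -> `|s - t| < eta -> `|u s - u t| < e].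
  apply: (cab _ _ (fun eta s => forall t,
    a <= t <= b -> `|s - t| < eta -> `|u s - u t| < e)) => r rab.
  have e20 : 0 < e / 2 by rewrite divr_gt0.
  have /subspace_continuousP/(_ r rab) uc' := uc.
  have : \forall s \near r, `[a, b]%classic s -> `|u r - u s| < e / 2.
    exact: cvgr_dist_lt uc' _ e20.
  move=> /nbhs_ballP[eta /= eta0 ur].
  have eta20 : 0 < eta / 2 by rewrite divr_gt0.
  near=> s z => sab t tab st.
  have {}sab : `[a, b]%classic s by exact: sab.
  have {}st : `|s - t| < z by exact: st.
  have sr : `|r - s| < eta / 2.
    suff : ball r (eta / 2) s by rewrite -ball_normE.
    by near: s; exact: nbhsx_ballx.
  have z2 : z < eta / 2 by near: z; exact: nbhs_right_lt.
  have us : `|u r - u s| < e / 2.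
    by apply: ur => //; rewrite -ball_normE /ball_ /=; lra.
  have ut : `|u r - u t| < e / 2.
    apply: ur; last by rewrite /= in_itv.
    by rewrite -ball_normE /ball_ /=; have := ler_distD s r t; lra.
  by rewrite distrC in us; have := ler_distD (u r) (u s) (u t); lra.
move=> H; have [eta [eta0 He]] : exists eta : R, 0 < eta /\
    (`[a, b]%classic `<=` [set s | forall t,
    a <= t <= b -> `|s - t| < eta -> `|u s - u t| < e]).
  apply: (@filter_ex _ (0 : R)^'+); apply: filterI H.
  exact: nbhs_right_gt.
by exists eta => // s t sab; apply: He; rewrite /= in_itv.
Unshelve. all: by end_near. Qed.

(** A single term [u K] passes its modulus to [l], and [l] to all late terms. The path through [l]
    and [u K] has five legs, hence [e / 5]. *)
Lemma uniform_cvg_unif_continuous (R : realType) (V : normedModType R)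
    (a b e : R) (u : nat -> R -> V) (l : R -> V) :
  (forall k, {within `[a, b], continuous (u k)}) ->
  {uniform `[a, b], u k @[k --> \oo] --> l} -> 0 < e ->
  exists2 eta : R, 0 < eta &
    \forall k \near \oo, forall s t, a <= s <= b -> a <= t <= b ->
      `|s - t| < eta -> `|u k s - u k t| < e.
Proof.
move=> uc ul e0; have e50 : 0 < e / 5%:R by rewrite divr_gt0.
have uK := uniform_cvg_on_dist ul e50.
have [K hK] := filter_ex uK.
have [eta eta0 he] := within_itv_unif_continuous (uc K) e50.
exists eta => //; apply: filterS uK => k hk s t sab tab st.
have sI : `[a, b]%classic s by rewrite /= in_itv.
have tI : `[a, b]%classic t by rewrite /= in_itv.
have := hK s sI; have := hK t tI; have := hk s sI; have := hk t tI.
have := he s t sab tab st.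
rewrite [`|u k t - l t|]distrC [`|u K s - l s|]distrC.
have := ler_distD (l s) (u k s) (u k t).
have := ler_distD (l t) (l s) (u k t).
have := ler_distD (u K s) (l s) (l t).
have := ler_distD (u K t) (u K s) (l t).
lra.
Qed.

(** One late term is bounded by compactness of the segment; [l] is within 1 of it, and the other
    late terms are within 1 of [l]. *)
Lemma uniform_cvg_bounded (R : realType) (V : normedModType R)
    (a b : R) (u : nat -> R -> V) (l : R -> V) :
  (forall k, {within `[a, b], continuous (u k)}) ->
  {uniform `[a, b], u k @[k --> \oo] --> l} ->
  exists M : R, (forall t, a <= t <= b -> `|l t| <= M) /\
    \forall k \near \oo, forall t, a <= t <= b -> `|u k t| <= M.
Proof.
move=> uc ul; have u1 := uniform_cvg_on_dist ul ltr01.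
have [K hK] := filter_ex u1.
have /ex_strict_bound_gt0[N N0 uN] : bounded_set (u K @` `[a, b]).
  apply: compact_bounded; apply: continuous_compact (uc K) _.
  exact: segment_compact.
have lN t : a <= t <= b -> `|l t| <= N + 1.
  move=> tab; have tI : `[a, b]%classic t by rewrite /= in_itv.
  have := hK t tI; have : `|u K t| < N by apply: uN; exists t.
  have := ler_normB (u K t) (u K t - l t); rewrite subKr; lra.
exists (N + 2); split=> [t /lN|]; first by lra.
apply: filterS u1 => k hk t tab.
have tI : `[a, b]%classic t by rewrite /= in_itv.
have := hk t tI; have := lN t tab.
have := ler_normD (u k t - l t) (l t); rewrite subrK; lra.
Qed.

Lemma solves_on_shift (R : realType) (V : normedModType R)
    (I J : set R) (F : R -> V -> V) (u : R -> V) (s : R) :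
  (forall t, J t -> I (t + s)) -> solves_on I F u ->
  solves_on J (fun t y => F (t + s) y) (fun t => u (t + s)).
Proof.
move=> JI uF.
have -> : (fun t => u (t + s)) = (fun t => u (1 * (t + s))).
  by apply/funext => t; rewrite mul1r.
have JI1 t : J t -> I (1 * (t + s)) by rewrite mul1r; exact: JI.
apply: solves_on_ext (solves_on_affine ltr01 JI1 uF) => t Jt.
by rewrite scale1r mul1r.
Qed.

Section Fast.
Context {R : realType} {n m : nat} (g : pfield R n m).
Hypotheses (hg : admissible g) (hgL : lipschitz_in_y g).
Hypothesis hglob : forall h x y, hull g h -> forward_solution h x 0 y !=set0.

(** Existence over the hull guarantees that [xget] in [sol] returns a solution and not its default
    value. *)
Lemma sol_translate (s : R) x y (T : R) :
  let u := sol (translate g s) x 0 y in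
  u 0 = y /\ solves_on `[0, T] (fun t z => g (x, z, t + s)) u.
Proof.
have [|u0 us] := @xgetPex _ (fun=> 0) (forward_solution (translate g s) x 0 y).
  exact: hglob (hull_translate hg s).
split=> //; apply: solves_on_subset us => t.
by rewrite /= !in_itv /= => /andP[->].
Qed.

(** Existence from time [s] on also comes from the hull: a solution for [translate g s] from time 0,
    moved by [s], solves the equation of [g]. Ultimate boundedness speaks of these solutions, the
    semiflow of those in [sol_translate]. *)
Lemma sol_shift (s : R) x y (T : R) :
  let u t := sol g x s y (t + s) in
  u 0 = y /\ solves_on `[0, T] (fun t z => g (x, z, t + s)) u.
Proof.
have [|u0 us] := @xgetPex _ (fun=> 0) (forward_solution g x s y).
  have [u [u0 us]] := hglob x y (hull_translate hg s).
  exists (fun t => u (t - s)); split; first by rewrite subrr.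
  have JI t : `[s, +oo[%classic t -> `[0, +oo[%classic (t - s).
    by rewrite /= !in_itv /= !andbT subr_ge0.
  apply: solves_on_ext (solves_on_shift JI us) => t _.
  by rewrite /translate /= subrK.
move=> u; split; first by rewrite /u add0r.
apply: solves_on_shift us => t.
by rewrite /= !in_itv /= !andbT => /andP[t0 _]; rewrite lerDr.
Qed.

Context (t0 : R) (eps : nat -> R) (xeps : nat -> R -> 'rV[R]_n)
  (yeps : nat -> R -> 'rV[R]_m).
Hypotheses (heps : forall k, 0 < eps k)
  (hy : forall k, solves_on `[0, t0]
         (fun t y => (eps k)^-1 *: g (xeps k t, y, t / eps k)) (yeps k)).

Lemma fast_time_solves (k : nat) (s t1 : R) :
  0 <= s -> eps k * (t1 + s) <= t0 ->
  solves_on `[0, t1] (fun t y => g (xeps k (eps k * (t + s)), y, t + s))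
    (fun t => yeps k (eps k * (t + s))).
Proof.
move=> s0 t1s.
have JI t : `[0, t1]%classic t -> `[0, t0]%classic (eps k * (t + s)).
  rewrite /= !in_itv /= => /andP[t_0 tt1]; rewrite mulr_ge0 ?addr_ge0 ?(ltW (heps k))//=.
  by rewrite (le_trans _ t1s)// ler_pM2l// lerD2r.
have H := solves_on_affine (heps k) JI (@hy k).
apply: solves_on_ext H => t _.
have ek0 : eps k != 0 by rewrite gt_eqF.
by rewrite scalerA divff// scale1r [eps k * _]mulrC mulfK.
Qed.

Context (xlim : R -> 'rV[R]_n).
Hypotheses (heps0 : eps k @[k --> \oo] --> (0 : R))
  (xc : forall k, {within `[0, t0], continuous (xeps k)})
  (hlim : {uniform `[0, t0], xeps k @[k --> \oo] --> xlim}).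

Lemma near_eps_lt (T eta : R) : 0 < eta -> \forall k \near \oo, eps k * T < eta.
Proof.
move=> eta0; have : eps k * T @[k --> \oo] --> 0 * T.
  by apply: cvgM => //; exact: cvg_cst.
rewrite mul0r => /(_ [set x | x < eta]); apply.
exact: lt_nbhsl.
Qed.

(** A window of fast length [T] has slow length [eps k * T], which tends to 0, so by equicontinuity
    the slow variable hardly moves along it. Closeness to [x] is asked at the end of the window
    because the final window ends at [t0]. *)
Lemma fast_near_frozen (M rho T e : R) : 0 < T -> 0 < e ->
  exists2 delta : R, 0 < delta & \forall k \near \oo, forall s t1 x u,
    `|x| <= M -> 0 <= s -> 0 <= t1 <= T -> eps k * (t1 + s) <= t0 ->
    `|xeps k (eps k * (t1 + s)) - x| <= delta -> `|u 0| <= rho ->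
    (forall t, 0 <= t <= t0 -> `|xeps k t| <= M) ->
    yeps k (eps k * s) = u 0 ->
    solves_on `[0, T] (fun t y => g (x, y, t + s)) u ->
    forall t, 0 <= t <= t1 -> `|yeps k (eps k * (t + s)) - u t| <= e.
Proof.
move=> T0 e0.
have [delta delta0 hd] := moving_frozen_close hg hgL M rho hglob (ltW T0) e0.
have d20 : 0 < delta / 2 by rewrite divr_gt0.
exists (delta / 2) => //.
have [eta eta0 xeta] := uniform_cvg_unif_continuous xc hlim d20.
near=> k => s t1 x u xM s0 /andP[t10 t1T] t1s xd u0 Mk yu us.
have ek := heps k.
have ekT : eps k * T < eta by near: k; exact: near_eps_lt.
apply: (hd s (fun t => xeps k (eps k * (t + s))) x u
  (fun t => yeps k (eps k * (t + s))) t1) => //; last first.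
- exact: fast_time_solves.
- by rewrite add0r.
move=> t /andP[t_0 tt1].
have tI : 0 <= eps k * (t + s) <= t0.
  rewrite mulr_ge0 ?addr_ge0 ?(ltW ek)//= (le_trans _ t1s)// ler_pM2l// lerD2r//.
have t1I : 0 <= eps k * (t1 + s) <= t0.
  by rewrite mulr_ge0 ?addr_ge0 ?(ltW ek)//=.
split; first exact: Mk.
have : `|xeps k (eps k * (t + s)) - xeps k (eps k * (t1 + s))| < delta / 2.
  have H : forall s t, 0 <= s <= t0 -> 0 <= t <= t0 ->
    `|s - t| < eta -> `|xeps k s - xeps k t| < delta / 2 by near: k.
  apply: H => //; rewrite -mulrBr opprD addrACA subrr addr0 normrM gtr0_norm//.
  apply: le_lt_trans ekT; rewrite ler_pM2l// distrC ger0_norm ?subr_ge0//.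
  by rewrite lerBlDr (le_trans t1T)// lerDl.
have := ler_distD (xeps k (eps k * (t1 + s))) (xeps k (eps k * (t + s))) x.
lra.
Unshelve. all: by end_near. Qed.

Hypothesis hbdd : forall K : set 'rV[R]_n, compact K ->
  uniformly_ultimately_bounded g K.

(* Block by block of fixed fast length, the frozen solution issued from the
   current value has entered the absorbing ball of radius [c] at the end of the
   block, and the actual solution is 1-close to it. *)
Lemma fast_bounded (y0 : 'rV[R]_m) : (forall k, yeps k 0 = y0) ->
  exists N : R, \forall k \near \oo, forall t, 0 <= t <= t0 -> `|yeps k t| <= N.
Proof.
move=> y00; have [M [_ xM]] := uniform_cvg_bounded xc hlim.
have [c c0 gc] := hbdd (@compact_clball R n M).
(* Room for the initial value, and for the absorbing ball enlarged by the error 1 of a block. *)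
pose rho := `|y0| + c + 1.
have rho0 : 0 < rho by rewrite /rho -addrA ltr_wpDl// addr_gt0.
(* The factor [m.+1] converts the sup-norm radius [rho] into a Euclidean one. *)
have [T0 T00 gT0] := gc (m.+1%:R * rho) (mulr_gt0 (ltr0Sn _ _) rho0).
pose T := T0 + 1; have Tgt0 : 0 < T by rewrite ltr_wpDl.
have T0T : T0 <= T by rewrite lerDl.
have [N uN] := frozen_solutions_bounded hg hgL M rho hglob (ltW Tgt0).
have [delta delta0 near_frozen] := fast_near_frozen M rho Tgt0 ltr01.
have [eta eta0 xeta] := uniform_cvg_unif_continuous xc hlim delta0.
have near_eps : \forall k \near \oo, eps k * T < eta by exact: near_eps_lt.
exists (N + 1).
apply: filterS (filterI (filterI near_frozen xeta) (filterI xM near_eps)).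
move=> k [[{}near_frozen {}xeta] [xMk ekT]]; have ek := heps k.
(* From a value in the [rho]-ball: the bound [N + 1] holds throughout the block, but the return to
   that ball is known only after its full length [T]. *)
have block s t1 : 0 <= s -> 0 <= t1 <= T -> eps k * (t1 + s) <= t0 ->
    `|yeps k (eps k * s)| <= rho ->
    `|yeps k (eps k * (t1 + s))| <= N + 1 /\
    (t1 = T -> `|yeps k (eps k * (t1 + s))| <= rho).
  move=> s0 t1T t1s ys; have /andP[t10 t1le] := t1T.
  have sI : 0 <= eps k * s <= t0.
    by rewrite mulr_ge0 ?(ltW ek)//= (le_trans _ t1s)// ler_pM2l// lerDr.
  have tI : 0 <= eps k * (t1 + s) <= t0 by rewrite mulr_ge0 ?addr_ge0 ?(ltW ek).
  pose x := xeps k (eps k * s).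
  pose u t := sol g x s (yeps k (eps k * s)) (t + s).
  have [u0 us] : u 0 = yeps k (eps k * s) /\
      solves_on `[0, T] (fun t z => g (x, z, t + s)) u by exact: sol_shift.
  have close : `|yeps k (eps k * (t1 + s)) - u t1| <= 1.
    apply: (near_frozen s t1 x u) => //.
    - exact: xMk.
    - apply/ltW/xeta => //; rewrite -mulrBr addrK normrM !ger0_norm ?(ltW ek)//.
      by apply: le_lt_trans ekT; rewrite ler_pM2l.
    - by rewrite u0.
    - by rewrite t10 lexx.
  have yu : `|yeps k (eps k * (t1 + s))| <= `|u t1| + 1.
    by rewrite -lerBlDl (le_trans (lerB_dist _ _)).
  split.
    rewrite (le_trans yu)// lerD2r; apply: (uN s x u); rewrite ?u0//.
    exact: xMk.
  move=> t1E; rewrite (le_trans yu)//.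
  have : `|u t1| <= c.
    apply: le_trans (norm_le_eunorm _) _; rewrite t1E; apply: gT0 => //.
      exact: xMk.
    by rewrite (le_trans (eunorm_le_norm _))// ler_pM2l.
  by rewrite /rho; have := normr_ge0 y0; lra.
have steps j : eps k * (j%:R * T) <= t0 -> `|yeps k (eps k * (j%:R * T))| <= rho.
  elim: j => [_|j IH jt].
    by rewrite mul0r mulr0 y00 /rho -addrA lerDl addr_ge0 ?ltW.
  have jE : j.+1%:R * T = T + j%:R * T by rewrite -[j.+1]add1n natrD mulrDl mul1r.
  rewrite jE in jt *.
  have jT0 : 0 <= j%:R * T by apply: mulr_ge0 => //; exact: ltW.
  have TT : 0 <= T <= T by rewrite lexx andbT ltW.
  apply: (block _ _ jT0 TT jt _).2 => //; apply: IH.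
  by rewrite (le_trans _ jt)// ler_pM2l// lerDr ltW.
(* [j] counts the complete blocks before [t]; one block, possibly shorter, remains. *)
move=> t /andP[t_0 tt0]; pose j := Num.truncn (t / eps k / T).
have q0 : 0 <= t / eps k / T by rewrite divr_ge0 ?divr_ge0// ltW.
have /andP[jle jlt] := truncn_itv q0.
have tE : t = eps k * ((t / eps k - j%:R * T) + j%:R * T).
  by rewrite subrK mulrC divfK// gt_eqF.
have jT : j%:R * T <= t / eps k by rewrite -ler_pdivlMr.
have jT0 : 0 <= j%:R * T by apply: mulr_ge0 => //; exact: ltW.
have jt : eps k * (j%:R * T) <= t0.
  by rewrite (le_trans _ tt0)// mulrC -ler_pdivlMr.
rewrite tE; apply: (block _ _ jT0 _ _ (steps j jt)).1; rewrite -?tE//.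
rewrite subr_ge0 jT /= lerBlDr -[T in T + _]mul1r -mulrDl addrC natr1.
by rewrite -ler_pdivrMr// ltW.
Qed.

End Fast.

(** * Inflated attractors *)

Lemma eudist_ge0 (R : realType) (n : nat) (x y : 'rV[R]_n) : 0 <= eudist x y.
Proof. exact: sqrtr_ge0. Qed.

Lemma eudistxx (R : realType) (n : nat) (x : 'rV[R]_n) : eudist x x = 0.
Proof.
by rewrite /eudist subrr /eunorm big1 ?sqrtr0// => i _; rewrite mxE expr0n.
Qed.

Lemma eudist_sym (R : realType) (n : nat) (x y : 'rV[R]_n) :
  eudist x y = eudist y x.
Proof.
by congr Num.sqrt; apply: eq_bigr => i _; rewrite -sqrrN !mxE opprB.
Qed.

Lemma eudist_eq0 (R : realType) (n : nat) (x y : 'rV[R]_n) :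
  eudist x y <= 0 -> x = y.
Proof.
move=> /(le_trans (norm_le_eunorm _)); rewrite normr_le0 => /eqP/subr0_eq.
exact.
Qed.

(** A crude triangle inequality through the sup norm, adapted to a first leg that is estimated in
    that norm. *)
Lemma eudist_le_add (R : realType) (n : nat) (x y z : 'rV[R]_n) :
  eudist x z <= n.+1%:R * (`|x - y| + eudist y z).
Proof.
apply: le_trans (eunorm_le_norm _) _; rewrite ler_pM2l//.
apply: le_trans (ler_distD y _ _) _; rewrite lerD2l; exact: norm_le_eunorm.
Qed.

Lemma eudist_continuous (R : realType) (n : nat) (x : 'rV[R]_n) :
  continuous (eudist x).
Proof.
move=> y.
have sc : \sum_(i < n) (x - z) 0 i ^+ 2 @[z --> y] -->
    \sum_(i < n) (x - y) 0 i ^+ 2.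
  apply: (@cvg_big _ _ _ _ _ (@add_continuous R) _ (nbhs y)) => i _.
  have yi : z 0 i @[z --> y] --> y 0 i by exact: coord_continuous.
  have xiy : (x - z) 0 i @[z --> y] --> (x - y) 0 i.
    have E (z : 'rV[R]_n) : (x - z) 0 i = x 0 i - z 0 i by rewrite !mxE.
    rewrite E (eq_cvg _ _ E).
    exact: (@cvgB _ _ _ (nbhs y) _ (fun=> x 0 i) _ _ _ (@cvg_cst _ _ _ _ _) yi).
  have E (z : 'rV[R]_n) : (x - z) 0 i ^+ 2 = (x - z) 0 i * (x - z) 0 i.
    exact: expr2.
  rewrite E (eq_cvg _ _ E).
  exact: (@cvgM _ _ (nbhs y) _ _ _ _ _ xiy xiy).
exact: (@cvg_comp _ _ _ _ Num.sqrt _ _ _ sc (@sqrt_continuous _ _)).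
Qed.

(** * Convergence to 0 in the extended reals, and the Hausdorff semidistance *)

Lemma cvge0P (R : realType) (I : Type) (F : set_system I) (u : I -> \bar R) :
  Filter F -> (forall i, (0 <= u i)%E) ->
  u i @[i --> F] --> 0%E <->
  forall e : R, 0 < e -> \forall i \near F, (u i <= e%:E)%E.
Proof.
move=> FF u0; split=> [/fine_cvgP[ufin u_0] e e0|ule].
  near=> i; have ui : u i \is a fin_num by near: i.
  rewrite -(fineK ui) lee_fin (le_trans (ler_norm _))//.
  rewrite -[leLHS]normrN -sub0r; near: i.
  exact: cvgr_dist_le u_0 _ e0.
apply/fine_cvgP; split.
  apply: filterS (ule 1 ltr01) => i ui1.
  by rewrite ge0_fin_numE// (le_lt_trans ui1)// ltry.
apply/cvgrPdist_le => e e0; apply: filterS (ule e e0) => i uie.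
have ufin : u i \is a fin_num by rewrite ge0_fin_numE// (le_lt_trans uie)// ltry.
by rewrite sub0r normrN ger0_norm ?fine_ge0// -lee_fin fineK.
Unshelve. all: by end_near. Qed.

Section Hdist.
Context {R : realType} {T : Type} (rho : T -> T -> R).

Lemma hdist_ge0 Y1 Y2 : (0 <= hdist rho Y1 Y2)%E.
Proof. by rewrite /hdist le_max lexx. Qed.

Lemma hdist_lt Y1 Y2 y1 (e : R) : (hdist rho Y1 Y2 < e%:E)%E -> Y1 y1 ->
  exists2 y2, Y2 y2 & rho y1 y2 < e.
Proof.
rewrite /hdist gt_max => /andP[_ supe] Y1y.
have /ereal_inf_lt[_ [y2 Y2y <-]] : (ereal_inf [set (rho y1 y2)%:E | y2 in Y2] < e%:E)%E.
  by apply: le_lt_trans supe; apply: ereal_sup_ubound; exists y1.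
by rewrite lte_fin; exists y2.
Qed.

Lemma hdist_set1_le y1 y2 Y2 (e : R) : Y2 y2 -> 0 <= e -> rho y1 y2 <= e ->
  (hdist rho [set y1] Y2 <= e%:E)%E.
Proof.
move=> Y2y e0 ye; rewrite /hdist ge_max lee_fin e0 /=.
apply: ge_ereal_sup => _ [_ -> <-].
by apply: (@le_trans _ _ (rho y1 y2)%:E); [apply: ereal_inf_lbound; exists y2|].
Qed.

End Hdist.

Section Inflation.
Context {R : realType} {n m : nat} (H : set (pfield R n m))
  (d : pfield R n m -> pfield R n m -> R) (K0 : set 'rV[R]_n)
  (A : set (pfield R n m * 'rV[R]_n * 'rV[R]_m)).
Hypotheses (hd : metrizes H d) (AH : A `<=` H `*` K0 `*` setT) (cA : compact A).

(** The quantity that [inflated] compares with the size of the inflation, as a function of the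
    points of the product space. *)
Definition base_dist (h : pfield R n m) (x : 'rV[R]_n)
    (p : pfield R n m * 'rV[R]_n * 'rV[R]_m) : R :=
  Num.max (d h p.1.1) (eudist x p.1.2).

Lemma skew_distE h x y p :
  skew_dist d (h, x, y) p = Num.max (base_dist h x p) (eudist y p.2).
Proof. by []. Qed.

(** [d] is tied to the topology only on [H], hence continuity relative to [A], whose base points lie
    in [H]. *)
Lemma base_dist_continuous h x : H h -> {within A, continuous (base_dist h x)}.
Proof.
move=> Hh; apply/subspace_continuousP => p Ap.
have Hp : H p.1.1 by case: (AH Ap) => -[].
case: hd => d0 dC dD dT.
have dc : d h q.1.1 @[q --> within A (nbhs p)] --> d h p.1.1.
  apply/cvgrPdist_lt => e e0.
  have near_p : \forall h' \near p.1.1, H h' -> d p.1.1 h' < e.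
    by apply: (dT _ [set h' | d p.1.1 h' < e] Hp).2; exists e.
  have p11 : q.1.1 @[q --> p] --> p.1.1.
    by apply: (@cvg_comp _ _ _ fst fst); exact: cvg_fst.
  have : \forall q \near p, A q -> `|d h p.1.1 - d h q.1.1| < e.
    have {}near_p : \forall q \near p, H q.1.1 -> d p.1.1 q.1.1 < e.
      exact: p11 _ near_p.
    apply: filterS near_p => q /[swap] Aq.
    have Hq : H q.1.1 by case: (AH Aq) => -[].
    move=> /(_ Hq) pq; rewrite ltr_norml.
    have := dD _ _ _ Hh Hp Hq; have := dD _ _ _ Hh Hq Hp.
    by rewrite (dC _ _ Hq Hp) => ? ?; apply/andP; split; lra.
  by [].
have ec : eudist x q.1.2 @[q --> within A (nbhs p)] --> eudist x p.1.2.
  apply: cvg_within_filter.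
  have p12 : q.1.2 @[q --> p] --> p.1.2.
    by apply: (@cvg_comp _ _ _ fst snd); [exact: cvg_fst|exact: cvg_snd].
  exact: (@cvg_comp _ _ _ (fun q => q.1.2) (eudist x) _ _ _ p12
    (@eudist_continuous _ _ x p.1.2)).
exact: (@cvg_comp _ _ _ (fun q => (d h q.1.1, eudist x q.1.2))
  (fun z => Num.max z.1 z.2) _ _ _ (cvg_pair dc ec)
  (@max_continuous _ R (d h p.1.1, eudist x p.1.2))).
Qed.

Lemma skew_dist_continuous h x y :
  H h -> {within A, continuous (skew_dist d (h, x, y))}.
Proof.
move=> Hh; apply/subspace_continuousP => p Ap.
have /subspace_continuousP/(_ p Ap) bc := @base_dist_continuous h x Hh.
have ec : eudist y q.2 @[q --> within A (nbhs p)] --> eudist y p.2.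
  apply: cvg_within_filter.
  exact: (@cvg_comp _ _ _ snd (eudist y) _ _ _ cvg_snd
    (@eudist_continuous _ _ y p.2)).
exact: (@cvg_comp _ _ _ (fun q => (base_dist h x q, eudist y q.2))
  (fun z => Num.max z.1 z.2) _ _ _ (cvg_pair bc ec)
  (@max_continuous _ R (base_dist h x p, eudist y p.2))).
Qed.

Lemma skew_dist_inflated h x y p (delta : \bar R) : A p ->
  ((skew_dist d (h, x, y) p)%:E <= delta)%E -> inflated H d K0 A h x delta p.2.
Proof.
move=> Ap pd; exists p.1; last by case: p Ap {pd} => -[].
have [[Hp Kp] _] := AH Ap; split => //; apply: le_trans pd.
by rewrite lee_fin skew_distE le_max lexx.
Qed.

Lemma least_inflation_ge0 y B : (0 <= @least_inflation R m y B)%E.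
Proof.
by apply: le_ereal_inf_tmp => _ [delta [delta0 _] <-]; rewrite lee_fin ltW.
Qed.

(** The point [p] serves twice: its base part puts [p.2] into the inflated section, its fibre part
    bounds the distance from [y]. *)
Lemma least_inflation_le h x y p (e : R) : A p -> 0 < e ->
  skew_dist d (h, x, y) p <= e ->
  (least_inflation y (inflated H d K0 A h x) <= e%:E)%E.
Proof.
move=> Ap e0 pe; apply: ereal_inf_lbound; exists e => //; split=> //.
apply: (@hdist_set1_le _ _ _ _ p.2) (ltW e0) _.
  by apply: (@skew_dist_inflated _ _ y) => //; rewrite lee_fin.
by apply: le_trans pe; rewrite skew_distE le_max lexx orbT.
Qed.

(* The infimum defining the least inflation is attained: by compactness some
   point of [A] minimizes the distance to (h, x, y). *)
Lemma hdist_least_inflation h x y : A !=set0 -> H h ->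
  (hdist (@eudist R m) [set y]
    (inflated H d K0 A h x (least_inflation y (inflated H d K0 A h x))) <=
   least_inflation y (inflated H d K0 A h x))%E.
Proof.
move=> A0 Hh; set delta := least_inflation _ _.
have [p /set_mem Ap pmin] := compact_EVT_min A0 cA (@skew_dist_continuous h x y Hh).
have pd : ((skew_dist d (h, x, y) p)%:E <= delta)%E.
  apply: le_ereal_inf_tmp => _ [e [e0 ye] <-].
  (* The slack [e'] is there because the distance to the inflated section need not be attained. *)
  rewrite lee_fin; apply/ler_addgt0Pr => e' e'0.
  have [z [[h1 x1] [H1 K1 hx1] Az] yz] :
      exists2 z, inflated H d K0 A h x e%:E z & eudist y z < e + e'.
    apply: (@hdist_lt _ _ _ [set y]) => //.
    by apply: le_lt_trans ye _; rewrite lte_fin ltrDl.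
  apply: (@le_trans _ _ (skew_dist d (h, x, y) (h1, x1, z))).
    by apply: pmin; apply/mem_set.
  rewrite skew_distE ge_max (ltW yz) andbT.
  by rewrite lee_fin in hx1; rewrite (le_trans hx1)// lerDl ltW.
(* The minimizer lies in the section inflated by [delta], at fibre distance at most [delta]; this
   also covers an infinite [delta]. *)
apply: le_trans (pd); apply: (@hdist_set1_le _ _ _ _ p.2).
- exact: (@skew_dist_inflated h x y).
- by rewrite skew_distE le_max eudist_ge0 orbT.
- by rewrite skew_distE le_max lexx orbT.
Qed.

(** The points of [A] at fibre distance at least [e] from the section form a compact set [C], on
    which the base distance has a positive minimum. If the section is empty, then [C] is all of
    [A]. *)
Lemma asection_upper_semicontinuous h x (e : R) : H h -> 0 < e ->
  exists2 delta : R, 0 < delta & forall p, A p -> base_dist h x p < delta ->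
    exists2 y, asection A h x y & eudist y p.2 < e.
Proof.
move=> Hh e0.
pose C := A `&` \bigcap_(y in asection A h x) [set p | e <= eudist y p.2].
have cC : compact C.
  apply: compact_closedI => //; apply: closed_bigI => y _.
  apply: (@closed_comp _ _ (fun p : pfield R n m * 'rV[R]_n * 'rV[R]_m =>
    eudist y p.2) [set t | e <= t]); last exact: closed_ge.
  move=> p _; exact: (@cvg_comp _ _ _ snd (eudist y) _ _ _ cvg_snd
    (@eudist_continuous _ _ y p.2)).
have inC p : A p -> ~ C p -> exists2 y, asection A h x y & eudist y p.2 < e.
  move=> Ap nCp; apply: contrapT => ny; apply: nCp; split=> // y yA.
  by rewrite /= leNgt; apply/negP => yp; apply: ny; exists y.
have [C0|/set0P/negP/negPn/eqP C0] := pselect (C !=set0); last first.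
  by exists 1 => // p Ap _; apply: inC => //; rewrite C0.
have CA : C `<=` A by move=> p [].
have bc : {within C, continuous (base_dist h x)}.
  exact: continuous_subspaceW CA (@base_dist_continuous h x Hh).
have [c /set_mem Cc cmin] := compact_EVT_min C0 cC bc.
exists (base_dist h x c).
  (* At base distance 0 the minimizer would itself belong to the section, at distance 0 from it. *)
  rewrite ltNge; apply/negP; rewrite /base_dist ge_max => /andP[hc xc].
  have [[Hc _] _] := AH Cc.1.
  have hE : h = c.1.1.
    case: hd => d0 _ _ _; have [d_ge0 d_eq0] := d0 _ _ Hh Hc.
    by apply/d_eq0/eqP; rewrite eq_le hc.
  have xE := eudist_eq0 xc.
  case: Cc => Ac /(_ c.2); rewrite /asection /= eudistxx leNgt e0 /=.
  have cE : c = (h, x, c.2) by rewrite hE xE -!surjective_pairing.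
  by rewrite -cE => /(_ Ac).
move=> p Ap pc; apply: inC => // Cp.
by move: pc; rewrite ltNge => /negP; apply; apply: cmin; apply/mem_set.
Qed.

End Inflation.

(** All translates lie in the hull, where [d]-balls are neighbourhoods, so convergence for [d] gives
    convergence in the compact-open topology. *)
Lemma omega_limit_hull (R : realType) (n m : nat) (g h : pfield R n m)
    (d : pfield R n m -> pfield R n m -> R) (tau : nat -> R) :
  admissible g -> metrizes (hull g) d -> hull g h ->
  tau k @[k --> \oo] --> +oo ->
  d (translate g (tau k)) h @[k --> \oo] --> (0 : R) ->
  omega_limit g h.
Proof.
move=> hg [d0 dC _ dT] Hh tauoo dh; split=> //; exists tau => // U hU.
have Hg k : hull g (translate g (tau k)) by exact: hull_translate.
have [e e0 eU] : exists2 e : R, 0 < e &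
    forall h', hull g h' -> d h h' < e -> U h'.
  by apply/(dT h U Hh); apply: filterS hU => h' Uh' _.
suff : \forall k \near \oo, U (translate g (tau k)) by [].
have dhe : \forall k \near \oo, `|0 - d (translate g (tau k)) h| < e.
  exact: cvgr_dist_lt dh _ e0.
apply: filterS dhe => k; rewrite sub0r normrN => dk.
by apply: eU => //; rewrite dC// (le_lt_trans (ler_norm _)).
Qed.

(** * Convergence of the fast solutions to the attractor *)

Section Approach.
Context {R : realType} {n m : nat} (g : pfield R n m)
  (d : pfield R n m -> pfield R n m -> R) (K0 : set 'rV[R]_n)
  (A : set (pfield R n m * 'rV[R]_n * 'rV[R]_m))
  (t0 : R) (eps : nat -> R) (y0 : 'rV[R]_m) (xeps : nat -> R -> 'rV[R]_n)
  (yeps : nat -> R -> 'rV[R]_m) (xlim : R -> 'rV[R]_n).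
Hypotheses (hg : admissible g) (hgL : lipschitz_in_y g)
  (hglob : forall h x y, hull g h -> forward_solution h x 0 y !=set0)
  (hbdd : forall K : set 'rV[R]_n, compact K -> uniformly_ultimately_bounded g K)
  (ht0 : 0 < t0) (heps : forall k, 0 < eps k)
  (heps0 : eps k @[k --> \oo] --> (0 : R))
  (xc : forall k, {within `[0, t0], continuous (xeps k)})
  (hy : forall k, solves_on `[0, t0]
         (fun t y => (eps k)^-1 *: g (xeps k t, y, t / eps k)) (yeps k))
  (hy0 : forall k, yeps k 0 = y0)
  (hlim : {uniform `[0, t0], xeps k @[k --> \oo] --> xlim})
  (hK0 : K0 (xlim t0))
  (hA : forall D : set 'rV[R]_m, bounded_set D ->
        hdist (skew_dist d) (skew_semiflow tau @` (hull g `*` K0 `*` D)) A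
          @[tau --> +oo] --> 0%E).

(* Follow the solution of the frozen system over the last fast-time window of
   fixed length: it starts in a fixed bounded set, hence ends near [A]. *)
Lemma approach_attractor (e : R) : 0 < e ->
  \forall k \near \oo, exists2 p, A p &
    skew_dist d (translate g (t0 / eps k), xlim t0, yeps k t0) p <= e.
Proof.
move=> e0.
have [M [lM xM]] := uniform_cvg_bounded xc hlim.
have [N yN] := fast_bounded hg hgL hglob heps hy heps0 xc hlim hbdd hy0.
(* One half for freezing the parameter, one for the distance of the semiflow from [A]; the divisor
   pays for [eudist_le_add]. *)
pose e1 := e / m.+1%:R / 2.
have e10 : 0 < e1 by rewrite !divr_gt0.
have e1E : m.+1%:R * (e1 + e1) = e.
  by rewrite -splitr mulrC divfK// pnatr_eq0.
have e1e : e1 <= e.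
  have N1 : 1 <= m.+1%:R :> R by rewrite ler1n.
  by rewrite -[leRHS]e1E; nra.
have bN : bounded_set (@clball R m N).
  exists N; split; first exact: num_real.
  by move=> N' NN' y /le_trans; apply; exact: ltW.
have [T [T0 TA]] : exists T : R, 0 < T /\
    (hdist (skew_dist d) (skew_semiflow T @` (hull g `*` K0 `*` clball N)) A
      < e1%:E)%E.
  have e120 : 0 < e1 / 2 by rewrite divr_gt0.
  have /cvge0P hA0 := hA bN.
  apply: (@filter_ex _ (+oo : set_system R)); apply: filterI.
    exact: nbhs_pinfty_gt.
  apply: filterS (hA0 _ _ e120) => [t|t]; last exact: hdist_ge0.
  by move=> /le_lt_trans; apply; rewrite lte_fin; lra.
have [delta delta0 nf] := fast_near_frozen hg hgL hglob heps hy heps0 xc hlim M N T0 e10.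
have epsT : \forall k \near \oo, eps k * T < t0 by exact: near_eps_lt.
have xd := uniform_cvg_on_dist hlim delta0.
apply: filterS (filterI (filterI yN nf) (filterI (filterI epsT xd) xM)).
move=> k [[{}yN {}nf] [[{}epsT {}xd] {}xM]]; have ek := heps k.
have t0I : 0 <= t0 <= t0 by rewrite (ltW ht0) lexx.
(* Start of the last window, nonnegative by [epsT]. *)
pose s := t0 / eps k - T.
have sE : T + s = t0 / eps k by rewrite /s addrC subrK.
have ekt : eps k * (t0 / eps k) = t0 by rewrite mulrC divfK// gt_eqF.
have s0 : 0 <= s by rewrite subr_ge0 ler_pdivlMr// mulrC ltW.
have sI : 0 <= eps k * s <= t0.
  rewrite mulr_ge0 ?(ltW ek)//= -[leRHS]ekt -sE ler_pM2l//.
  by rewrite lerDr ltW.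
pose y := yeps k (eps k * s).
have [u0 us] := sol_translate hg hglob s (xlim t0) y T.
have TT : 0 <= T <= T by rewrite (ltW T0) lexx.
have close : `|yeps k t0 - sol (translate g s) (xlim t0) 0 y T| <= e1.
  rewrite -[in yeps k t0]ekt -sE.
  apply: (nf s T (xlim t0) (sol (translate g s) (xlim t0) 0 y)) => //.
  - exact: lM.
  - by rewrite sE ekt.
  - by rewrite sE ekt; apply/ltW/xd; rewrite /= in_itv.
  - by rewrite u0; exact: yN.
have [q Aq pq] : exists2 q, A q &
    skew_dist d (skew_semiflow T (translate g s, xlim t0, y)) q < e1.
  apply: (hdist_lt TA); exists (translate g s, xlim t0, y) => //.
  split; last exact: yN.
  by split => //; exact: hull_translate.
(* The base flow leads from [s] at the start of the window to exactly the required translate at its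
   end. *)
have tE : translate (translate g s) T = translate g (t0 / eps k).
  by apply/funext => p; rewrite /translate /= -addrA sE.
exists q => //; move: pq; rewrite /skew_semiflow /skew_dist /= tE.
rewrite !gt_max => /andP[/andP[dq xq] yq].
rewrite !ge_max (le_trans (ltW dq))//= (le_trans (ltW xq))//=.
apply: le_trans (eudist_le_add _ _ _) _; rewrite -e1E ler_pM2l//.
by apply: lerD close _; exact: ltW.
Qed.

End Approach.

Theorem theorem4p4 (R : realType) (n m : nat)
    (f : 'rV[R]_n * 'rV[R]_m -> 'rV[R]_n) (a b : R)
    (g : pfield R n m) (d : pfield R n m -> pfield R n m -> R)
    (x0 : 'rV[R]_n) (y0 : 'rV[R]_m) (t0 : R) (eps : nat -> R)
    (xeps : nat -> R -> 'rV[R]_n) (yeps : nat -> R -> 'rV[R]_m)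
    (xlim : R -> 'rV[R]_n) (r : R)
    (A : set (pfield R n m * 'rV[R]_n * 'rV[R]_m))
    (hf : continuous f)
    (ha : 0 < a) (hb : 0 < b)
    (hfab : forall x y, eunorm (f (x, y)) <= a + b * eunorm x)
    (hg : admissible g)
    (hgL : lipschitz_in_y g)
    (hd : metrizes (hull g) d)
    (hglob : forall h x y, hull g h -> forward_solution h x 0 y !=set0)
    (hbdd : forall K : set 'rV[R]_n, compact K -> uniformly_ultimately_bounded g K)
    (ht0 : 0 < t0)
    (heps : forall k, 0 < eps k)
    (heps_dec : nonincreasing_seq eps)
    (heps0 : eps k @[k --> \oo] --> (0 : R))
    (hx : forall k, xeps k 0 = x0 /\
       solves_on `[0, t0] (fun t x => f (x, yeps k t)) (xeps k))
    (hy : forall k, yeps k 0 = y0 /\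
       solves_on `[0, t0]
         (fun t y => (eps k)^-1 *: g (xeps k t, y, t / eps k)) (yeps k))
    (hlim : {uniform `[0, t0], xeps k @[k --> \oo] --> xlim})
    (hr : 0 < r)
    (hA : global_attractor (hull g) d (tube xlim t0 r) A) :
  let Y k (tau : R) := yeps k (eps k * tau) in
  let tau k := t0 / eps k in
  let infl k := inflated (hull g) d (tube xlim t0 r) A
                  (translate g (tau k)) (xlim t0) in
  let delta k := least_inflation (Y k (tau k)) (infl k) in
  let dist_to (y : 'rV[R]_m) B := hdist (@eudist R m) [set y] B in
  [/\ delta k @[k --> \oo] --> 0%E,
      dist_to (Y k (tau k)) (infl k (delta k)) @[k --> \oo] --> 0%E &
      forall h0, hull g h0 -> d (translate g (tau k)) h0 @[k --> \oo] --> (0 : R) ->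
        omega_limit g h0 /\
        dist_to (Y k (tau k)) (asection A h0 (xlim t0)) @[k --> \oo] --> 0%E].
Proof.
move=> Y tau infl delta dist_to.
have YE k : Y k (tau k) = yeps k t0.
  by rewrite /Y /tau mulrC divfK// gt_eqF.
have [AH A0 cA _ attr] := hA.
have Hg k : hull g (translate g (tau k)) by exact: hull_translate.
have xK : tube xlim t0 r (xlim t0).
  exists t0; first by rewrite /= in_itv /= ltW ?lexx.
  by exists 0; rewrite ?addr0//= -[0](subrr (xlim t0)) -/(eudist _ _) eudistxx ltW.
have approach e : 0 < e -> \forall k \near \oo, exists2 p, A p &
    skew_dist d (translate g (tau k), xlim t0, yeps k t0) p <= e.
  apply: (approach_attractor hg hgL hglob hbdd ht0 heps heps0 _ _ _ hlim xK attr).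
  - by move=> k; apply: solves_on_continuous (hx k).2.
  - by move=> k; apply: (hy k).2.
  - by move=> k; apply: (hy k).1.
have deltale e : 0 < e -> \forall k \near \oo, (delta k <= e%:E)%E.
  move=> e0; apply: filterS (approach e e0) => k [p Ap pe].
  by rewrite /delta YE; apply: least_inflation_le Ap e0 pe.
split.
- apply/cvge0P => // k; exact: least_inflation_ge0.
(* The infimum is attained, so the distance is at most [delta k] and (i) applies. *)
- apply/cvge0P => [k|e e0]; first exact: hdist_ge0.
  apply: filterS (deltale e e0) => k; apply: le_trans.
  by rewrite /dist_to /delta; apply: hdist_least_inflation.
move=> h0 Hh0 dh0; split.
  apply: (omega_limit_hull hg hd Hh0) dh0.
  rewrite /tau; apply/cvgryPgt => M.
  (* [|M| + 1] is positive whatever the sign of [M], so it can be a divisor. *)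
  have M1 : 0 < t0 / (`|M| + 1) by rewrite divr_gt0// ltr_wpDl.
  have epsM : \forall k \near \oo, `|0 - eps k| < t0 / (`|M| + 1).
    exact: cvgr_dist_lt heps0 _ M1.
  apply: filterS epsM => k.
  rewrite sub0r normrN gtr0_norm// => epsk.
  rewrite ltr_pdivlMr//; rewrite ltr_pdivlMr ?ltr_wpDl// in epsk.
  apply: le_lt_trans epsk; rewrite mulrC ler_pM2l//.
  by rewrite (le_trans (ler_norm _))// lerDl.
apply/cvge0P => [k|e e0]; first exact: hdist_ge0.
pose e1 := e / m.+1%:R / 2.
have e10 : 0 < e1 by rewrite !divr_gt0.
have e1E : m.+1%:R * (e1 + e1) = e.
  by rewrite -splitr mulrC divfK// pnatr_eq0.
have [eta eta0 usc] := asection_upper_semicontinuous hd AH cA (xlim t0) Hh0 e10.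
(* [e1] controls the fibre. In the base, [eta / 3] from the attractor and [eta / 3] from the
   convergence to [h0] add up to less than [eta]. *)
pose e2 := Num.min e1 (eta / 3).
have eta30 : 0 < eta / 3 by rewrite divr_gt0.
have e20 : 0 < e2 by rewrite lt_min e10.
have d_eta : \forall k \near \oo, `|0 - d (translate g (tau k)) h0| < eta / 3.
  exact: cvgr_dist_lt dh0 _ eta30.
apply: filterS (filterI (approach e2 e20) d_eta).
move=> k [[p Ap] pe] /=; rewrite sub0r normrN => dk.
have [[Hp _] _] := AH _ Ap.
rewrite skew_distE /base_dist !ge_max in pe.
have /andP[/andP[dp xp] yp] := pe.
have e2eta : e2 <= eta / 3 by rewrite ge_min lexx orbT.
have e2e1 : e2 <= e1 by rewrite ge_min lexx.
have [y hy' yp'] : exists2 y, asection A h0 (xlim t0) y & eudist y p.2 < e1.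
  apply: usc => //; rewrite /base_dist gt_max; apply/andP; split; last by lra.
  case: hd => _ dC dD _; have := dD _ _ _ Hh0 (Hg k) Hp.
  rewrite (dC _ _ Hh0 (Hg k)); have := ler_norm (d (translate g (tau k)) h0).
  lra.
rewrite YE; apply: (hdist_set1_le hy' (ltW e0)).
apply: le_trans (eudist_le_add _ p.2 _) _; rewrite -e1E ler_pM2l//.
apply: lerD; first by rewrite (le_trans (norm_le_eunorm _))// (le_trans yp).
by rewrite eudist_sym ltW.
Qed.
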